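(* Let $K$ be a complex K3 surface with $\mathrm{Pic}(K)=\mathbb{Z}h$ and $h^2=2d$. Then for each $d\in\mathbb{Z}_{>0}$, the set of lattices $\Gamma_\alpha$, for $\alpha\in Br(K)_2$, $\alpha\neq0$, is partitioned into three isometry classes. If $4B_\alpha h+h^2\equiv 0\pmod 4$, the isometry class of $\Gamma_\alpha$ is determined by $B_\alpha h\in\frac12\mathbb{Z}/\mathbb{Z}$ and $B_\alpha^2\in\frac12\mathbb{Z}/\mathbb{Z}$; otherwise it is determined by $B_\alpha h\in\frac12\mathbb{Z}/\mathbb{Z}$ only. More precisely, for $\alpha=(a_\alpha,\lambda_\alpha)\neq 0$: (1) If $a_\alpha=0$ (equivalently $B_\alpha h\equiv0$), then $\Gamma_\alpha^*/\Gamma_\alpha\cong\mathbb{Z}/2d\mathbb{Z}\oplus\mathbb{Z}/2\mathbb{Z}\oplus\mathbb{Z}/2\mathbb{Z}$, and there are $2^{20}-1$ such $\alpha$. (a) If $d$ is even there are two isometry classes of such lattices: one class has $2^9(2^{10}+1)-1$ elements and is characterized by $\lambda_\alpha^2\equiv0\pmod 4$ (equivalently $B_\alpha^2\equiv0$); the other has $2^9(2^{10}-1)$ elements and is characterized by $\lambda_\alpha^2\equiv 2\pmod 4$ (equivalently $B_\alpha^2\equiv\frac12$). (b) If $d$ is odd, these $2^{20}-1$ lattices are all isometric. (2) If $a_\alpha=1$ (equivalently $B_\alpha h\equiv\frac12$), then $\Gamma_\alpha^*/\Gamma_\alpha\cong\mathbb{Z}/8d\mathbb{Z}$, and there are $2^{20}$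 such $\alpha$. (a) If $d$ is even these $2^{20}$ lattices are all isometric. (b) If $d$ is odd there are two isometry classes: one has $2^9(2^{10}+1)$ elements and is characterized by $\lambda_\alpha^2\equiv 0\pmod4$ (equivalently $B_\alpha^2\equiv0$); the other has $2^9(2^{10}-1)$ elements and is characterized by $\lambda_\alpha^2\equiv2\pmod 4$ (equivalently $B_\alpha^2\equiv\frac12$).
   Context: $T_K=\mathrm{Pic}(K)^\perp\subset H^2(K,\mathbb{Z})$ is the transcendental lattice and $Br(K)_2\cong\mathrm{Hom}(T_K,\mathbb{Z}/2\mathbb{Z})$. For $\alpha\neq0$, $\Gamma_\alpha=\ker(\alpha:T_K\to\mathbb{Z}/2\mathbb{Z})$, an index two sublattice, with dual $\Gamma_\alpha^*=\{x\in\Gamma_\alpha\otimes\mathbb{Q}: x\gamma\in\mathbb{Z}\ \forall\gamma\in\Gamma_\alpha\}$. Fix an isometry $H^2(K,\mathbb{Z})\cong U\oplus\Lambda'$, $\Lambda'\cong U^2\oplus E_8(-1)^2$, with $h=(1,d)$ and $v:=(1,-d)$ in the first summand $U$, so $T_K=\mathbb{Z}v\oplus\Lambda'$. Each $\alpha$ is written $\alpha=(a_\alpha,\lambda_\alpha)$ with $a_\alpha\in\{0,1\}$, $\lambda_\alpha\in\Lambda'$ (unique mod $2\Lambda'$), via $\alpha(nv+\lambda)=a_\alpha n+\lambda_\alpha\cdot\lambda \bmod 2$. The B-field lift is $B_\alpha=((0,a_\alpha/2),\lambda_\alpha/2)\in\frac12(U\oplus\Lambda')$, so $B_\alpha h=a_\alpha/2$,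 $B_\alpha^2=\lambda_\alpha^2/4$; any B-field representative $B$ of $\alpha$ (a class in $\frac12H^2(K,\mathbb{Z})$ mapping to $\alpha$ via the exponential sequence, unique up to $H^2(K,\mathbb{Z})+\frac12\mathrm{Pic}(K)$) has the same $Bh \bmod\mathbb{Z}$. *)

(* Defs.v *)
From HB Require Import structures.
From mathcomp Require Import all_boot all_order all_algebra.
From mathcomp Require Import boolp.
Set Implicit Arguments. Unset Strict Implicit. Unset Printing Implicit Defensive.
Import Order.TTheory GRing.Theory Num.Theory.
Local Open Scope ring_scope.

(* The lattice T_K = Z v (+) Lambda', Lambda' = U^2 (+) E8(-1)^2,          *)
(* in coordinates: index 0 is v (v^2 = -2d), indices 1..20 are a basis of   *)
(* Lambda' (first U (+) U, then E8(-1) (+) E8(-1)).                         *)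

Definition Ugram : 'M[int]_2 := \matrix_(i, j) (i != j)%:R.

(* E8 Dynkin diagram (T_{2,3,5}): chain 0-1-2-3-4-5-6, node 7 attached to 4 *)
Definition E8adj (i j : 'I_8) : bool :=
  ((i : nat) + 1 == j)%N && (j <= 6)%N || ((j : nat) + 1 == i)%N && (i <= 6)%N
  || ((i : nat) == 4)%N && ((j : nat) == 7)%N || ((i : nat) == 7)%N && ((j : nat) == 4)%N.

Definition E8m : 'M[int]_8 :=
  \matrix_(i, j) (if i == j then -2 else if E8adj i j then 1 else 0).

Definition LamGram : 'M[int]_20 :=
  block_mx (block_mx Ugram 0 0 Ugram) 0 0 (block_mx E8m 0 0 E8m).

Definition TGram (d : nat) : 'M[int]_21 :=
  block_mx ((- (2 * d)%:Z)%:M : 'M[int]_1) 0 0 LamGram.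

Definition Tform (d : nat) (x y : 'cV[int]_21) : int := (x^T *m TGram d *m y) 0 0.

Definition Lform (x y : 'cV[int]_20) : int := (x^T *m LamGram *m y) 0 0.

(* Br(K)_2 = Hom(T_K, Z/2): a homomorphism is given by its values on the basis *)
Definition Br2 := 'rV['F_2]_21.

Definition alpha_ev (al : Br2) (x : 'cV[int]_21) : 'F_2 :=
  (al *m map_mx (fun z : int => z%:~R) x) 0 0.

Definition a_of (al : Br2) : 'F_2 := al 0 ord0.

Definition embL (mu : 'cV[int]_20) : 'cV[int]_21 := col_mx (0 : 'cV[int]_1) mu.

Definition lam_rep (al : Br2) (lam : 'cV[int]_20) : Prop :=
  forall mu : 'cV[int]_20, alpha_ev al (embL mu) = (Lform lam mu)%:~R.

Definition lam_sq (al : Br2) (k : int) : Prop :=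
  exists lam : 'cV[int]_20, lam_rep al lam /\ (Lform lam lam = k %[mod 4])%Z.

Definition Gamma (al : Br2) (x : 'cV[int]_21) : Prop := alpha_ev al x = 0.

Definition toQ (x : 'cV[int]_21) : 'cV[rat]_21 := map_mx (fun z : int => z%:~R) x.

Definition Gamma_dual (d : nat) (al : Br2) (q : 'cV[rat]_21) : Prop :=
  forall g, Gamma al g ->
    (q^T *m map_mx (fun z : int => z%:~R) (TGram d) *m toQ g) 0 0 \is a Num.int.

(* Gamma_alpha^*/Gamma_alpha is isomorphic to the abelian group A:
   there is a surjective homomorphism Gamma_alpha^* -> A with kernel Gamma_alpha *)
Definition disc_iso (d : nat) (al : Br2) (A : zmodType) : Prop :=
  exists phi : 'cV[rat]_21 -> A,
    [/\ forall x y, Gamma_dual d al x -> Gamma_dual d al y -> phi (x + y) = phi x + phi y,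
        forall a : A, exists x, Gamma_dual d al x /\ phi x = a
      & forall x, Gamma_dual d al x -> (phi x = 0 <-> exists g, Gamma al g /\ x = toQ g)].

Definition isometric (d : nat) (al be : Br2) : Prop :=
  exists f : 'cV[int]_21 -> 'cV[int]_21,
    [/\ forall x, Gamma al x -> Gamma be (f x),
        forall x y, Gamma al x -> Gamma al y -> f (x + y) = f x + f y,
        forall x y, Gamma al x -> Gamma al y -> Tform d (f x) (f y) = Tform d x y,
        forall x y, Gamma al x -> Gamma al y -> f x = f y -> x = y
      & forall y, Gamma be y -> exists x, Gamma al x /\ f x = y].

(* Main.v *)
(* Write alpha = (a, lambda), so that Gamma_alpha consists of the n v + mu with
   a n + lambda.mu even.

   Isometries.  For e isotropic and w orthogonal to e with w^2 = 2k, the Eichler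
   transvection x |-> x + (x.e) w - (x.w + k (x.e)) e of T_K pulls alpha back to
   (a, lambda + (alpha(w) + k alpha(e)) e + alpha(e) w), modulo 2.  With e, f the
   basis of the first hyperbolic plane of Lambda', such moves bring lambda to
   f + q e, and w = v changes q by a - d.  So a and the parity of
   q = lambda^2 / 2 always suffice, and a alone suffices when a + d is odd.

   Invariants.  An element y of N Gamma^* lying in Gamma is one whose products
   with Gamma are divisible by N, so the following are invariants of the lattice:
   whether 2d kills the elements of Gamma^*/Gamma of order dividing 8d (true iff
   a = 0); for a = 0 and d even, whether the elements of order 2 have integral
   square (iff lambda^2 = 0 mod 4); for a = 1 and d odd, whether some element p
   with 8p in Gamma has 64 p^2 = 32 - 8d mod 64 (iff lambda^2 = 2 mod 4).

   Counting.  The sum of (-1)^(lambda^2 / 2) over Lambda'/2 is multiplicative in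
   orthogonal sums; it is 2 for U and 16 for E8, hence 2^10 for Lambda'. *)
Require Import Defs.
From HB Require Import structures.
From mathcomp Require Import all_boot all_order all_algebra.
From mathcomp Require Import boolp.
From mathcomp Require Import zify ring.
Import Order.TTheory GRing.Theory Num.Theory.
Local Open Scope ring_scope.

(** * The lattice Lambda' *)

(** The lattice is even: a triangular H with H + H^T equal to the Gram matrix expresses x^2 / 2 as
    x^T H x over the integers, and so gives a quadratic form modulo 2. *)
Definition Uhalf : 'M[int]_2 := \matrix_(i, j) (i < j)%N%:R.

Definition E8half : 'M[int]_8 :=
  \matrix_(i, j) (if i == j then -1 else if (i < j)%N && E8adj i j then 1 else 0).

Definition LamHalf : 'M[int]_20 :=
  block_mx (block_mx Uhalf 0 0 Uhalf) 0 0 (block_mx E8half 0 0 E8half).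

Lemma Ugram_half : Ugram = Uhalf + Uhalf^T.
Proof.
by apply/matrixP => i j; rewrite !mxE; case: i j => [[|[|//]] ?] [[|[|//]] ?].
Qed.

Lemma E8m_half : E8m = E8half + E8half^T.
Proof.
apply/matrixP => i j; rewrite !mxE.
by case: i j => [[|[|[|[|[|[|[|[|//]]]]]]]] ?] [[|[|[|[|[|[|[|[|//]]]]]]]] ?].
Qed.

Lemma LamGram_half : LamGram = LamHalf + LamHalf^T.
Proof.
rewrite /LamHalf (tr_block_mx (m1 := 4) (n1 := 4) (m2 := 16) (n2 := 16)).
rewrite (tr_block_mx (m1 := 2) (n1 := 2)) (tr_block_mx (m1 := 8) (n1 := 8)) !trmx0.
rewrite (add_block_mx (m1 := 4) (n1 := 4) (m2 := 16) (n2 := 16)).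
rewrite (add_block_mx (m1 := 2) (n1 := 2)) (add_block_mx (m1 := 8) (n1 := 8)) !addr0.
by rewrite -Ugram_half -E8m_half.
Qed.

(** Inverse of the E8 Cartan matrix in the labelling of [E8adj]; [E8inv] changes the sign because
    the form is negative definite. *)
Definition E8inv_table : seq (seq nat) :=
  [:: [:: 2; 3; 4; 5; 6; 4; 2; 3];
      [:: 3; 6; 8; 10; 12; 8; 4; 6];
      [:: 4; 8; 12; 15; 18; 12; 6; 9];
      [:: 5; 10; 15; 20; 24; 16; 8; 12];
      [:: 6; 12; 18; 24; 30; 20; 10; 15];
      [:: 4; 8; 12; 16; 20; 14; 7; 10];
      [:: 2; 4; 6; 8; 10; 7; 4; 5];
      [:: 3; 6; 9; 12; 15; 10; 5; 8]]%N.

Definition E8inv : 'M[int]_8 :=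
  \matrix_(i, j) - (nth 0 (nth [::] E8inv_table i) j)%:Z.

Lemma E8mK : E8m *m E8inv = 1%:M.
Proof.
apply/matrixP => i j; rewrite !mxE !big_ord_recl big_ord0 !mxE.
by case: i j => [[|[|[|[|[|[|[|[|//]]]]]]]] ?] [[|[|[|[|[|[|[|[|//]]]]]]]] ?].
Qed.

Lemma UgramK : Ugram *m Ugram = 1%:M.
Proof.
apply/matrixP => i j; rewrite !mxE !big_ord_recl big_ord0 !mxE.
by case: i j => [[|[|//]] ?] [[|[|//]] ?].
Qed.

Definition LamInv : 'M[int]_20 :=
  block_mx (block_mx Ugram 0 0 Ugram) 0 0 (block_mx E8inv 0 0 E8inv).

Lemma LamGramK : LamGram *m LamInv = 1%:M.
Proof.
rewrite /LamGram /LamInv.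
rewrite (mulmx_block (m1:=4) (m2:=16) (n1:=4) (n2:=16) (p1:=4) (p2:=16)).
rewrite !mulmx0 !mul0mx !addr0 !add0r.
rewrite (mulmx_block (m1:=2) (m2:=2) (n1:=2) (n2:=2) (p1:=2) (p2:=2)).
rewrite (mulmx_block (m1:=8) (m2:=8) (n1:=8) (n2:=8) (p1:=8) (p2:=8)).
rewrite !mulmx0 !mul0mx !addr0 !add0r UgramK E8mK.
by rewrite -(scalar_mx_block 2 2) -(scalar_mx_block 8 8) -(scalar_mx_block 4 16).
Qed.

Lemma LamInvK : LamInv *m LamGram = 1%:M.
Proof. exact: mulmx1C LamGramK. Qed.

Lemma LamGramT : LamGram^T = LamGram.
Proof. by rewrite LamGram_half linearD /= trmxK addrC. Qed.

Lemma trmx_11 (M : 'M[int]_1) : M^T = M.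
Proof. by rewrite [M]mx11_scalar tr_scalar_mx. Qed.

Lemma LformC x y : Lform x y = Lform y x.
Proof. by rewrite /Lform -[x^T *m _ *m y]trmx_11 !trmx_mul trmxK LamGramT mulmxA. Qed.

Lemma LformDl x y z : Lform (x + y) z = Lform x z + Lform y z.
Proof. by rewrite /Lform linearD /= !mulmxDl mxE. Qed.

Lemma LformDr x y z : Lform z (x + y) = Lform z x + Lform z y.
Proof. by rewrite /Lform !mulmxDr mxE. Qed.

Lemma LformZl c x y : Lform (c *: x) y = c * Lform x y.
Proof. by rewrite /Lform linearZ /= -!scalemxAl mxE. Qed.

Lemma LformZr c x y : Lform x (c *: y) = c * Lform x y.
Proof. by rewrite LformC LformZl LformC. Qed.

Lemma LformNl x y : Lform (- x) y = - Lform x y.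
Proof. by rewrite -scaleN1r LformZl mulN1r. Qed.

Lemma LformNr x y : Lform x (- y) = - Lform x y.
Proof. by rewrite LformC LformNl LformC. Qed.

Lemma Lform0l x : Lform 0 x = 0.
Proof. by rewrite -(scale0r 0) LformZl mul0r. Qed.

Lemma Lform0r x : Lform x 0 = 0.
Proof. by rewrite LformC Lform0l. Qed.

Definition LformE := (LformDl, LformDr, LformNl, LformNr, LformZl, LformZr, Lform0l, Lform0r).

Definition Lhalf (x : 'cV[int]_20) : int := (x^T *m LamHalf *m x) 0 0.

Lemma Lform_Lhalf x : Lform x x = 2 * Lhalf x.
Proof.
rewrite /Lform LamGram_half mulmxDr mulmxDl mxE mulr_natl mulr2n; congr (_ + _).
by rewrite /Lhalf -[x^T *m LamHalf *m x]trmx_11 !trmx_mul trmxK mulmxA.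
Qed.

Lemma Lform_perfect (r : 'rV[int]_20) :
  exists x, forall y, Lform x y = (r *m y) 0 0.
Proof.
by exists (r *m LamInv)^T => y; rewrite /Lform trmxK -(mulmxA r) LamInvK mulmx1.
Qed.

(** Unimodularity: the row x^T G is divisible by N entrywise, and the integral inverse of the Gram
    matrix G turns the quotient back into a vector. *)
Lemma Lform_dvd (N : int) x :
  (forall y, (N %| Lform x y)%Z) -> exists y, x = N *: y.
Proof.
move=> dvdN; pose r : 'rV[int]_20 := \row_j ((x^T *m LamGram) ord0 j %/ N)%Z.
have def_r : x^T *m LamGram = N *: r.
  apply/rowP => j; rewrite [RHS]mxE [r _ _]mxE mulrC divzK //.
  by have := dvdN (delta_mx j ord0); rewrite /Lform -colE !mxE.
exists (r *m LamInv)^T; rewrite -linearZ /= scalemxAl -def_r -mulmxA LamGramK.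
by rewrite mulmx1 trmxK.
Qed.

(* [tv n mu] is n v + mu. *)
Definition tv (n : int) (mu : 'cV[int]_20) : 'cV[int]_21 :=
  col_mx (n%:M : 'cV[int]_1) mu.

Lemma tvP x : exists n mu, x = tv n mu.
Proof.
exists (usubmx (x : 'cV_(1 + 20)) 0 0), (dsubmx (x : 'cV_(1 + 20))).
by rewrite /tv -mx11_scalar vsubmxK.
Qed.

Lemma tvD n mu m nu : tv n mu + tv m nu = tv (n + m) (mu + nu).
Proof. by rewrite /tv (add_col_mx (m1:=1)) -raddfD. Qed.

Lemma tvZ c n mu : c *: tv n mu = tv (c * n) (c *: mu).
Proof. by rewrite /tv (scale_col_mx (m1:=1)) scale_scalar_mx. Qed.

Lemma tv_inj n mu m nu : tv n mu = tv m nu -> n = m /\ mu = nu.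
Proof.
move=> /(@eq_col_mx _ 1 20 1) [] /matrixP/(_ 0 0) h ->.
by move: h; rewrite !mxE.
Qed.

Lemma Tform_tv d n mu m nu :
  Tform d (tv n mu) (tv m nu) = - (2 * d%:Z) * n * m + Lform mu nu.
Proof.
rewrite /Tform /tv /TGram (tr_col_mx (m1:=1)).
rewrite (mul_row_block (n1:=1) (n2:=20) (p1:=1) (p2:=20)).
rewrite !mulmx0 addr0 add0r (mul_row_col (n1:=1)) mxE /Lform; congr (_ + _).
rewrite tr_scalar_mx -!scalar_mxM mxE eqxx mulr1n PoszM. ring.
Qed.

(** * Integral lifts of Brauer classes *)

Lemma intF2_eq0 (z : int) : (z%:~R == 0 :> 'F_2) = (2 %| z)%Z.
Proof. by rewrite (dvdz_pcharf (pchar_Fp (isT : prime 2))). Qed.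

Lemma intF2_eq (y z : int) : (y%:~R == z%:~R :> 'F_2) = (2 %| y - z)%Z.
Proof. by rewrite -subr_eq0 -intrB intF2_eq0. Qed.

Lemma natrF2 (x : 'F_2) : ((x : nat)%:Z)%:~R = x.
Proof. exact: natr_Zp. Qed.

(** Integral lifts of a_alpha and lambda_alpha, determined only modulo 2, so that later arguments
    are about divisibility of integers. *)
Definition rep (al : Br2) (a : int) (lam : 'cV[int]_20) : Prop :=
  forall n mu, alpha_ev al (tv n mu) = (a * n + Lform lam mu)%:~R.

Lemma alpha_ev_tv al n mu :
  alpha_ev al (tv n mu) =
  a_of al * n%:~R + (rsubmx (al : 'rV_(1 + 20)) *m map_mx (fun z : int => z%:~R) mu) 0 0.
Proof.
rewrite /alpha_ev /tv (map_col_mx _ (m1:=1)) -[X in X *m _](hsubmxK (al : 'rV_(1+20))).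
rewrite (mul_row_col (n1:=1)) mxE; congr (_ + _).
rewrite !mxE big_ord1 !mxE /= mulr1n /a_of; congr (al _ _ * _).
exact: val_inj.
Qed.

Lemma rep_ex al : exists lam, rep al (a_of al : nat)%:Z lam.
Proof.
pose r : 'rV[int]_20 := \row_j ((rsubmx (al : 'rV_(1 + 20)) 0 j : nat)%:Z).
have [lam lamP] := Lform_perfect r; exists lam => n mu.
rewrite alpha_ev_tv intrD intrM natrF2 lamP; congr (_ + _).
rewrite !mxE rmorph_sum /=; apply: eq_bigr => j _.
by rewrite intrM [r _ _]mxE natrF2 !mxE.
Qed.

Lemma rep_a {al a lam} : rep al a lam -> a_of al = a%:~R.
Proof.
move=> /(_ 1 0); rewrite alpha_ev_tv Lform0r addr0 mulr1.
by rewrite map_mx0 mulmx0 mxE addr0 mulr1.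
Qed.

Lemma Gamma_tv {al a lam} : rep al a lam ->
  forall n mu, Gamma al (tv n mu) <-> (2 %| a * n + Lform lam mu)%Z.
Proof. by move=> h n mu; rewrite /Gamma h -intF2_eq0; split=> /eqP. Qed.

Lemma alpha_ev_inj al be : alpha_ev al =1 alpha_ev be -> al = be.
Proof.
move=> eq_ev; apply/rowP => j; have := eq_ev (delta_mx j ord0).
by rewrite /alpha_ev map_delta_mx -!colE !mxE.
Qed.

Lemma rep_eq {al be a b lam mu nu} : rep al a lam -> rep be b mu ->
  (2 %| a - b)%Z -> lam = mu + 2 *: nu -> al = be.
Proof.
move=> rl rm dab def_lam; apply: alpha_ev_inj => x; have [n [x' ->]] := tvP x.
apply/eqP; rewrite rl rm intF2_eq def_lam !LformE.
have -> : a * n + (Lform mu x' + 2 * Lform nu x') - (b * n + Lform mu x')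
   = (a - b) * n + 2 * Lform nu x' by ring.
by rewrite rpredD ?dvdz_mulr ?dvdz_mull.
Qed.

Lemma lam_rep_tv {al a lam} : rep al a lam -> lam_rep al lam.
Proof.
move=> h mu; have := h 0 mu; rewrite mulr0 add0r => <-; congr (alpha_ev al _).
by rewrite /embL /tv raddf0.
Qed.

Lemma lam_rep_mod2 {al lam mu} : lam_rep al lam -> lam_rep al mu ->
  exists nu, lam = mu + 2 *: nu.
Proof.
move=> rl rm; have [|nu def_nu] := @Lform_dvd 2 (lam - mu).
  by move=> y; rewrite !LformE -intF2_eq; apply/eqP; rewrite -rl -rm.
by exists nu; rewrite -def_nu addrC subrK.
Qed.

(** Replacing lambda by lambda + 2 nu changes lambda^2 / 2 by 2 (lambda.nu + nu^2), so its parity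
    depends only on alpha. *)
Lemma lam_sqP {al a lam} (k : int) : rep al a lam ->
  lam_sq al (2 * k) <-> (2 %| Lhalf lam - k)%Z.
Proof.
move=> /lam_rep_tv rl; split.
  case=> mu [rm]; have [nu ->] := lam_rep_mod2 rm rl.
  move/eqP; rewrite eqz_mod_dvd => dv.
  have := Lform_Lhalf (lam + 2 *: nu); rewrite !LformE (LformC nu).
  have := Lform_Lhalf lam; have := Lform_Lhalf nu; move: dv; rewrite !LformE (LformC nu).
  move=> /dvdzP[q Hq] H1 H2 H3; apply/dvdzP; exists (q - Lform lam nu - Lform nu nu); lia.
move=> /dvdzP[q Hq]; exists lam; split=> //.
apply/eqP; rewrite eqz_mod_dvd Lform_Lhalf; apply/dvdzP; exists q; lia.
Qed.

(** * Eichler transvections *)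

Lemma TformC d x y : Tform d x y = Tform d y x.
Proof.
have [n [mu ->]] := tvP x; have [m [nu ->]] := tvP y.
rewrite !Tform_tv (LformC nu); ring.
Qed.

Lemma TformDl d x y z : Tform d (x + y) z = Tform d x z + Tform d y z.
Proof. by rewrite /Tform linearD /= !mulmxDl mxE. Qed.

Lemma TformZl d c x y : Tform d (c *: x) y = c * Tform d x y.
Proof. by rewrite /Tform linearZ /= -!scalemxAl mxE. Qed.

Lemma TformDr d x y z : Tform d z (x + y) = Tform d z x + Tform d z y.
Proof. by rewrite TformC TformDl !(TformC d z). Qed.

Lemma TformZr d c x y : Tform d x (c *: y) = c * Tform d x y.
Proof. by rewrite TformC TformZl TformC. Qed.

Lemma TformNl d x y : Tform d (- x) y = - Tform d x y.
Proof. by rewrite -scaleN1r TformZl mulN1r. Qed.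

Lemma TformNr d x y : Tform d x (- y) = - Tform d x y.
Proof. by rewrite TformC TformNl TformC. Qed.

Definition TformE := (TformDl, TformDr, TformNl, TformNr, TformZl, TformZr).

Definition eichler d (e w : 'cV[int]_21) (k : int) (x : 'cV[int]_21) :=
  x + Tform d x e *: w - (Tform d x w + k * Tform d x e) *: e.

Section Eichler.

Variables (d : nat) (e w : 'cV[int]_21) (k : int).
Hypotheses (ee0 : Tform d e e = 0) (we0 : Tform d w e = 0).
Hypothesis (ww2k : Tform d w w = 2 * k).

Lemma eichlerD x y : eichler d e w k (x + y) = eichler d e w k x + eichler d e w k y.
Proof. by apply/colP => i; rewrite /eichler !TformE !mxE; ring. Qed.

Lemma eichler_isom x y : Tform d (eichler d e w k x) (eichler d e w k y) = Tform d x y.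
Proof.
rewrite /eichler !TformE (TformC d e w) (TformC d w y) (TformC d e y).
rewrite ee0 we0 ww2k; ring.
Qed.

Lemma eichlerK : cancel (eichler d e w k) (eichler d e (- w) k).
Proof.
move=> x; rewrite [LHS]/eichler /eichler !TformE ee0 we0 ww2k (TformC d e w) we0.
by apply/colP => i; rewrite !mxE; ring.
Qed.

End Eichler.

(** An isometry of the whole of T_K carrying alpha to beta, hence Gamma_alpha onto Gamma_beta. The
    explicit inverse makes symmetry and transitivity immediate. *)
Definition gequiv (d : nat) (al be : Br2) : Prop :=
  exists f g : 'cV[int]_21 -> 'cV[int]_21,
    [/\ cancel f g, cancel g f, forall x y, f (x + y) = f x + f y,
        forall x y, Tform d (f x) (f y) = Tform d x y
      & forall x, alpha_ev be (f x) = alpha_ev al x].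

Lemma gequiv_sym d al be : gequiv d al be -> gequiv d be al.
Proof.
case=> f [g [fK gK fD fT fe]]; exists g, f; split=> // [x y|x y|x].
- by rewrite -{1}(gK x) -{1}(gK y) -fD fK.
- by rewrite -fT !gK.
- by rewrite -fe gK.
Qed.

Lemma gequiv_trans d al be ga : gequiv d al be -> gequiv d be ga -> gequiv d al ga.
Proof.
case=> f [g [fK gK fD fT fe]] [f' [g' [fK' gK' fD' fT' fe']]].
exists (f' \o f), (g \o g'); split=> [x|x|x y|x y|x] /=.
- by rewrite fK' fK.
- by rewrite gK gK'.
- by rewrite fD fD'.
- by rewrite fT' fT.
- by rewrite fe' fe.
Qed.

Lemma gequiv_isometric d al be : gequiv d al be -> isometric d al be.
Proof.
case=> f [g [fK gK fD fT fe]]; exists f; split=> // [x|x y _ _|y].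
- by rewrite /Gamma fe.
- exact: (can_inj fK).
- by exists (g y); rewrite gK /Gamma -fe gK.
Qed.

Lemma rep_mk a lam : exists al, rep al a lam.
Proof.
exists (row_mx (a%:~R)%:M (map_mx (fun z : int => z%:~R) (lam^T *m LamGram)) : 'rV_(1 + 20)).
move=> n mu; rewrite alpha_ev_tv intrD intrM; congr (_ * _ + _).
  transitivity (((a%:~R : 'F_2)%:M : 'M_1) 0 0); last by rewrite mxE eqxx mulr1n.
  rewrite -(row_mxEl (n1 := 1) _ (map_mx (fun z : int => z%:~R) (lam^T *m LamGram))).
  by rewrite /a_of; congr fun_of_matrix; apply: val_inj.
by rewrite row_mxKr -map_mxM mxE.
Qed.

(** The lambda of the pullback of alpha by the transvection at e along w0 v + w, with k half the
    square of w0 v + w. Signs are taken positive, which is harmless modulo 2. *)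
Definition move_lam (a : int) (lam e : 'cV[int]_20) w0 w k : 'cV[int]_20 :=
  lam + (a * w0 + Lform lam w + k * Lform lam e) *: e + Lform lam e *: w.

Lemma gequiv_move {d al be a lam e w0 w k} : rep al a lam ->
  Lform e e = 0 -> Lform w e = 0 -> - d%:Z * w0 ^+ 2 + Lhalf w = k ->
  rep be a (move_lam a lam e w0 w k) -> gequiv d be al.
Proof.
move=> ral ee we def_k rbe.
have TE: Tform d (tv 0 e) (tv 0 e) = 0 by rewrite Tform_tv ee; ring.
have TW: Tform d (tv w0 w) (tv 0 e) = 0 by rewrite Tform_tv we; ring.
have TWW: Tform d (tv w0 w) (tv w0 w) = 2 * k.
  by rewrite Tform_tv -def_k Lform_Lhalf; ring.
have TWN: Tform d (- tv w0 w) (tv 0 e) = 0 by rewrite TformNl TW oppr0.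
have TWWN: Tform d (- tv w0 w) (- tv w0 w) = 2 * k by rewrite !TformE TWW opprK.
exists (eichler d (tv 0 e) (tv w0 w) k), (eichler d (tv 0 e) (- tv w0 w) k); split.
- exact: eichlerK.
- by move=> x; rewrite -{1}(opprK (tv w0 w)) eichlerK.
- exact: eichlerD.
- exact: eichler_isom.
move=> x; have [n [mu ->]] := tvP x.
apply/eqP; rewrite /eichler -scaleNr !tvZ !tvD ral rbe intF2_eq !Tform_tv /move_lam.
rewrite !LformE (LformC mu e) (LformC mu w) (LformC w mu) (LformC e mu).
set p := Lform mu e; set q := Lform mu w; apply/dvdzP.
(* Half the difference of the two values: terms with opposite signs count twice, and n v contributes
   - 2d w0 n through its product with w0 v. *)
exists (- (q * Lform lam e) + d%:Z * w0 * n * Lform lam e - k * p * Lform lam e); ring.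
Qed.

(** * Reduction to canonical form *)

Definition hyp (x y z t : int) : 'cV[int]_20 :=
  col_mx (col_mx (\col_i (if i == 0 then x else y) : 'cV_2)
                 (\col_i (if i == 0 then z else t) : 'cV_2)) (0 : 'cV_16).

Lemma Lform_hyp x y z t x' y' z' t' :
  Lform (hyp x y z t) (hyp x' y' z' t') = x * y' + y * x' + z * t' + t * z'.
Proof.
rewrite /Lform /hyp /LamGram (tr_col_mx (m1:=4) (m2:=16)).
rewrite (mul_row_block (n1:=4) (n2:=16) (p1:=4) (p2:=16)) (mul_row_col (n1:=4)).
rewrite trmx0 !mul0mx !mulmx0 !addr0.
rewrite (tr_col_mx (m1:=2) (m2:=2)).
rewrite (mul_row_block (n1:=2) (n2:=2) (p1:=2) (p2:=2)) (mul_row_col (n1:=2)).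
rewrite !mulmx0 addr0 add0r mxE.
by rewrite !mxE !big_ord_recl !big_ord0 !mxE !big_ord_recl !big_ord0 !mxE /=; ring.
Qed.

Definition e1 := hyp 1 0 0 0.
Definition f1 := hyp 0 1 0 0.
Definition e2 := hyp 0 0 1 0.
Definition f2 := hyp 0 0 0 1.

Lemma e1e1 : Lform e1 e1 = 0. Proof. by rewrite Lform_hyp. Qed.
Lemma e1f1 : Lform e1 f1 = 1. Proof. by rewrite Lform_hyp. Qed.
Lemma f1e1 : Lform f1 e1 = 1. Proof. by rewrite Lform_hyp. Qed.
Lemma f1f1 : Lform f1 f1 = 0. Proof. by rewrite Lform_hyp. Qed.
Definition hypE := (e1e1, e1f1, f1e1, f1f1).

Lemma Lhalf_eq x k : Lform x x = 2 * k -> Lhalf x = k.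
Proof. by rewrite Lform_Lhalf; lia. Qed.

(** Projection to the orthogonal complement of the first hyperbolic plane, integral because that
    plane is unimodular. *)
Definition perp1 (mu : 'cV[int]_20) := mu - Lform mu f1 *: e1 - Lform mu e1 *: f1.

Lemma perp1_e mu : Lform (perp1 mu) e1 = 0.
Proof. by rewrite /perp1 !LformE !hypE; ring. Qed.

Lemma perp1_f mu : Lform (perp1 mu) f1 = 0.
Proof. by rewrite /perp1 !LformE !hypE; ring. Qed.

Lemma odd_dvdz (n : int) : ~~ (2 %| n)%Z -> exists k, n = 2 * k + 1.
Proof.
move=> h; exists (n %/ 2)%Z; rewrite [LHS](divz_eq n 2).
have : (n %% 2)%Z != 0 by apply: contra h => /eqP h; apply/dvdz_mod0P.
have := ltz_pmod n (isT : 0 < 2 :> int); have := modz_ge0 n (isT : 2 != 0 :> int); lia.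
Qed.

Lemma even_dvdz (n : int) : (2 %| n)%Z -> exists k, n = 2 * k.
Proof. by case/dvdzP=> k ->; exists k; rewrite mulrC. Qed.

Section Reduction.

Variables (d : nat) (a : int).

(** Write lambda = x e1 + y f1 + w with y odd. The transvection at e1 along w adds y w, which
    cancels w modulo 2, and otherwise changes only the coefficient of e1. *)
Lemma reduce_e1 al lam : rep al a lam -> ~~ (2 %| Lform lam e1)%Z ->
  exists be q, gequiv d al be /\ rep be a (f1 + q *: e1).
Proof.
move=> ral /odd_dvdz[y' def_y]; set w := perp1 lam; pose k := Lhalf w.
have [be rbe] := rep_mk a (move_lam a lam e1 0 w k).
exists be, (Lform lam f1 + Lform lam w + k * Lform lam e1); split.
  apply/gequiv_sym/(gequiv_move ral _ _ _ rbe); rewrite ?hypE ?perp1_e //; lia.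
have [ga rga] := rep_mk a (f1 + (Lform lam f1 + Lform lam w + k * Lform lam e1) *: e1).
suff -> : be = ga by [].
(* With y = 2 y' + 1 the coefficients are now 2 y' + 1 at f1 and 2 y' + 2 at w; nu is half of the
   excess over the canonical form. *)
apply: (rep_eq rbe rga (nu := y' *: f1 + (y' + 1) *: w)); first by rewrite subrr.
have def_lam : lam = Lform lam f1 *: e1 + Lform lam e1 *: f1 + w.
  by apply/colP=> i; rewrite /w /perp1 !mxE; ring.
rewrite /move_lam -/w; move: (Lform lam w) (Lform lam f1) (Lform lam e1) def_y def_lam.
move=> z x y -> ->; apply/colP=> i; rewrite !mxE.
by move: (w i 0) (e1 i 0) (f1 i 0) => *; ring.
Qed.

(** The transvection at f1 along w adds lambda.w + k (lambda.f1) to lambda.e1. The second hyperbolic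
    plane contains a w for which this is odd. *)
Lemma reduce_f1 al lam : rep al a lam -> (2 %| Lform lam e1)%Z ->
  ~~ (2 %| Lform lam f1)%Z ->
  exists be mu, [/\ gequiv d al be, rep be a mu & ~~ (2 %| Lform mu e1)%Z].
Proof.
move=> ral evy oddx.
have [w [wf we oddw]] : exists w, [/\ Lform w f1 = 0, Lform w e1 = 0
    & ~~ (2 %| Lform lam w + Lhalf w * Lform lam f1)%Z].
  have [ev2|odd2] := boolP (2 %| Lform lam e2)%Z; last first.
    exists e2; split; rewrite ?Lform_hyp // (@Lhalf_eq e2 0) ?Lform_hyp //.
    by rewrite mul0r addr0.
  have [ev2'|odd2] := boolP (2 %| Lform lam f2)%Z; last first.
    exists f2; split; rewrite ?Lform_hyp // (@Lhalf_eq f2 0) ?Lform_hyp //.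
    by rewrite mul0r addr0.
  (* When lambda.e2 and lambda.f2 are both even, e2 + f2 has k = 1, and the odd term lambda.f1
     decides. *)
  exists (e2 + f2); split; rewrite ?LformE ?Lform_hyp // (@Lhalf_eq (e2 + f2) 1).
    by rewrite mul1r rpredDl // rpredD.
  by rewrite !LformE !Lform_hyp.
have [be rbe] := rep_mk a (move_lam a lam f1 0 w (Lhalf w)).
exists be, (move_lam a lam f1 0 w (Lhalf w)); split=> //.
  by apply/gequiv_sym/(gequiv_move ral _ _ _ rbe); rewrite ?hypE //; lia.
rewrite /move_lam !LformE we !hypE !mulr0 addr0 add0r mulr1.
by rewrite rpredDl.
Qed.

(** A nonzero alpha is odd at some n v + mu, and stays so after projecting mu off the first plane,
    as lambda.e1 and lambda.f1 are even. The transvection at e1 along the result adds an odd number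
    to lambda.f1. *)
Lemma reduce_perp al lam : al != 0 -> rep al a lam -> (2 %| Lform lam e1)%Z ->
  (2 %| Lform lam f1)%Z ->
  exists be mu, [/\ gequiv d al be, rep be a mu & ~~ (2 %| Lform mu f1)%Z].
Proof.
move=> al0 ral evy evx.
have [n [mu oddz]] : exists n mu, ~~ (2 %| a * n + Lform lam mu)%Z.
  apply: contrapT => noz; case/eqP: al0; apply: alpha_ev_inj => x.
  have [n [mu ->]] := tvP x; rewrite [RHS]/alpha_ev mul0mx mxE.
  apply/eqP; rewrite ral intF2_eq0; apply: contrapT => /negP oddz.
  by apply: noz; exists n, mu.
have [w [we wf lamw]] : exists w, [/\ Lform w e1 = 0, Lform w f1 = 0 & Lform lam w =
    Lform lam mu - Lform mu f1 * Lform lam e1 - Lform mu e1 * Lform lam f1].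
  by exists (perp1 mu); rewrite perp1_e perp1_f /perp1 !LformE.
set k := - d%:Z * n ^+ 2 + Lhalf w.
have [be rbe] := rep_mk a (move_lam a lam e1 n w k).
exists be, (move_lam a lam e1 n w k); split=> //.
  by apply/gequiv_sym/(gequiv_move ral _ _ _ rbe); rewrite ?hypE.
rewrite /move_lam !LformE wf lamw !hypE !mulr0 addr0 mulr1.
move: oddz; apply: contra => /even_dvdz[z def_z].
have [x def_x] := even_dvdz _ evx; have [y def_y] := even_dvdz _ evy.
rewrite def_x def_y in def_z.
apply/dvdzP; exists (z - x + Lform mu f1 * y + Lform mu e1 * x - k * y).
by rewrite [RHS]mulrC; lia.
Qed.

Lemma reduce al lam : al != 0 -> rep al a lam ->
  exists be q, gequiv d al be /\ rep be a (f1 + q *: e1).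
Proof.
move=> al0 ral.
have [evy|] := boolP (2 %| Lform lam e1)%Z; last exact: reduce_e1.
have red_f1 be mu : rep be a mu -> ~~ (2 %| Lform mu f1)%Z ->
    exists ga q, gequiv d be ga /\ rep ga a (f1 + q *: e1).
  move=> rbe; have [evy' oddx|oddy _] := boolP (2 %| Lform mu e1)%Z; last first.
    exact: reduce_e1 rbe oddy.
  have [ga [nu [bega rga oddy]]] := reduce_f1 _ _ rbe evy' oddx.
  have [de [q [gade rde]]] := reduce_e1 _ _ rga oddy.
  by exists de, q; split=> //; apply: gequiv_trans gade.
have [evx|oddx] := boolP (2 %| Lform lam f1)%Z; last exact: red_f1 ral oddx.
have [be [mu [albe rbe oddx]]] := reduce_perp _ _ al0 ral evy evx.
have [ga [q [bega rga]]] := red_f1 _ _ rbe oddx.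
by exists ga, q; split=> //; apply: gequiv_trans bega.
Qed.

Lemma Lhalf_canonical q : Lhalf (f1 + q *: e1) = q.
Proof. by apply: Lhalf_eq; rewrite !LformE !hypE; ring. Qed.

Lemma canonical_neq0 al q : rep al a (f1 + q *: e1) -> al != 0.
Proof.
move=> ral; apply/eqP => al0; have := ral 0 e1.
rewrite al0 /alpha_ev mul0mx mxE !LformE !hypE => /esym/eqP.
by rewrite !mulr0 addr0 add0r intF2_eq0.
Qed.

(* The transvection along [w = v], which has [w ^ 2 / 2 = - d], adds
   [a - d] to [q]. *)
Lemma canonical_shift al be q : rep al a (f1 + q *: e1) ->
  rep be a (f1 + (q + a - d%:Z) *: e1) -> gequiv d be al.
Proof.
move=> ral rbe; have rbe' : rep be a (move_lam a (f1 + q *: e1) e1 1 0 (- d%:Z)).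
  move=> n mu; rewrite rbe; congr ((_ + Lform _ _)%:~R).
  by apply/colP => i; rewrite /move_lam !LformE !hypE !mxE; ring.
apply: (gequiv_move ral _ _ _ rbe'); rewrite ?hypE ?Lform0l // (@Lhalf_eq 0 0).
  ring.
by rewrite Lform0l.
Qed.

(** The canonical forms are part of the conclusion so that lattice invariants can be evaluated on
    them, which relates the parities of p and q to alpha and beta. *)
Lemma gequiv_classify al be lam mu : al != 0 -> be != 0 ->
  rep al a lam -> rep be a mu ->
  exists ga de p q, [/\ gequiv d al ga, gequiv d be de,
    rep ga a (f1 + p *: e1), rep de a (f1 + q *: e1)
    & ~~ (2 %| a - d%:Z)%Z \/ (2 %| p - q)%Z -> gequiv d al be].
Proof.
move=> al0 be0 ral rbe.
have [ga [p [alga rga]]] := reduce _ _ al0 ral.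
have [de [q [bede rde]]] := reduce _ _ be0 rbe.
exists ga, de, p, q; split=> // parity.
apply: gequiv_trans alga _; apply/gequiv_sym/(gequiv_trans _ _ _ _ bede).
have canonical_eq (x y : Br2) r s : rep x a (f1 + r *: e1) -> rep y a (f1 + s *: e1) ->
    (2 %| r - s)%Z -> x = y.
  move=> rx ry /even_dvdz[z def_z]; apply: (rep_eq rx ry (nu := z *: e1)).
    by rewrite subrr.
  have -> : r = s + 2 * z by lia.
  by apply/colP => i; rewrite !mxE; ring.
have [evpq|/odd_dvdz[z def_z]] := boolP (2 %| p - q)%Z.
  rewrite (canonical_eq _ _ _ _ rga rde evpq).
  by exists id, id; split.
case: parity => [/odd_dvdz[t def_t]|/even_dvdz[]]; last by lia.
(* Here p and q differ in parity and a - d is odd, so p shifted by a - d has the parity of q. *)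
have [x rx] := rep_mk a (f1 + (p + a - d%:Z) *: e1).
have -> : de = x; last exact: canonical_shift rga rx.
apply: (canonical_eq _ _ _ _ rde rx).
by apply/dvdzP; exists (- z - t - 1); lia.
Qed.

End Reduction.

(** * Invariants of the discriminant form *)

(* y / N is in Gamma_alpha^* and y in Gamma_alpha. *)
Definition dual_mul (d : nat) (al : Br2) (N : int) (y : 'cV[int]_21) : Prop :=
  Gamma al y /\ forall g, Gamma al g -> (N %| Tform d y g)%Z.

(** For y = 8d p the vector z is 2d p: what 8d kills in Gamma^*/Gamma is already killed by 2d. *)
Definition disc_exponent (d : nat) (al : Br2) : Prop :=
  forall y, dual_mul d al (8 * d%:Z) y -> exists2 z, Gamma al z & y = 4 *: z.

(** For y = 2 p this is integrality of p^2 = y^2 / 4. *)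
Definition two_torsion_integral (d : nat) (al : Br2) : Prop :=
  forall y, dual_mul d al 2 y -> (4 %| Tform d y y)%Z.

(** For y = 8 p, the number 64 p^2 is never 32 - 8d modulo 64. That value is the square - 8d + 32
    d^2 (lambda^2 / 2) of - 2 v + 4d lambda when d and lambda^2 / 2 are odd. *)
Definition eight_torsion_avoids (d : nat) (al : Br2) : Prop :=
  forall y, dual_mul d al 8 y -> ~~ (64 %| Tform d y y + 8 * d%:Z - 32)%Z.

Lemma GammaD al x y : Gamma al x -> Gamma al y -> Gamma al (x + y).
Proof.
rewrite /Gamma /alpha_ev => hx hy.
by rewrite map_mxD mulmxDr mxE hx hy addr0.
Qed.

Lemma GammaZ al c x : Gamma al x -> Gamma al (c *: x).
Proof. by rewrite /Gamma /alpha_ev => hx; rewrite map_mxZ -scalemxAr mxE hx mulr0. Qed.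

(** * Invariance under isometries *)

Section Invariance.

Variables (d : nat) (al be : Br2) (f : 'cV[int]_21 -> 'cV[int]_21).
Hypothesis fG : forall x, Gamma al x -> Gamma be (f x).
Hypothesis fD : forall x y, Gamma al x -> Gamma al y -> f (x + y) = f x + f y.
Hypothesis fT : forall x y, Gamma al x -> Gamma al y -> Tform d (f x) (f y) = Tform d x y.
Hypothesis f_inj : forall x y, Gamma al x -> Gamma al y -> f x = f y -> x = y.
Hypothesis f_surj : forall y, Gamma be y -> exists x, Gamma al x /\ f x = y.

Lemma dual_mul_isom N x : Gamma al x -> dual_mul d be N (f x) <-> dual_mul d al N x.
Proof.
move=> Gx; split=> -[_ dvN]; split=> //.
- by move=> g Gg; rewrite -fT //; apply/dvN/fG.
- exact: fG.
- by move=> _ /f_surj[g [Gg <-]]; rewrite fT //; apply: dvN.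
Qed.

(** The map f is additive only on Gamma_alpha, so multiplication by 4 is written with sums inside
    it. *)
Lemma isom4 z : Gamma al z -> f (4 *: z) = 4 *: f z.
Proof.
have four (t : 'cV[int]_21) : 4 *: t = t + t + (t + t).
  by apply/colP => i; rewrite !mxE; ring.
by move=> Gz; rewrite !four !fD //; apply: GammaD.
Qed.

Lemma disc_exponent_isom : disc_exponent d al <-> disc_exponent d be.
Proof.
split=> h y [Gy dvy].
  have [x [Gx def_y]] := f_surj _ Gy.
  have [|z Gz def_x] := h x; first by rewrite -dual_mul_isom // def_y.
  by exists (f z); [exact: fG | rewrite -def_y def_x isom4].
have [|z Gz def_fy] := h (f y); first by rewrite dual_mul_isom.
have [x [Gx def_z]] := f_surj _ Gz; exists x => //.
have G4x := GammaZ _ 4 _ Gx.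
by apply: f_inj => //; rewrite isom4 // def_z.
Qed.

Lemma two_torsion_integral_isom : two_torsion_integral d al <-> two_torsion_integral d be.
Proof.
split=> h y [Gy dvy]; last by rewrite -fT //; apply: h; rewrite dual_mul_isom.
have [x [Gx def_y]] := f_surj _ Gy.
by rewrite -def_y fT //; apply: h; rewrite -dual_mul_isom // def_y.
Qed.

Lemma eight_torsion_avoids_isom : eight_torsion_avoids d al <-> eight_torsion_avoids d be.
Proof.
split=> h y [Gy dvy]; last by rewrite -fT //; apply: h; rewrite dual_mul_isom.
have [x [Gx def_y]] := f_surj _ Gy.
by rewrite -def_y fT //; apply: h; rewrite -dual_mul_isom // def_y.
Qed.

End Invariance.

(** * Values of the invariants in terms of a and lambda *)

Section Values.

Variables (d : nat) (al : Br2) (lam : 'cV[int]_20).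

Lemma Gamma_2 x : Gamma al (2 *: x).
Proof.
rewrite /Gamma /alpha_ev map_mxZ -scalemxAr mxE /=.
by have /eqP -> : (2%:~R == 0 :> 'F_2) by []; rewrite mul0r.
Qed.

(* Only 0 and alpha vanish on Gamma_alpha in Hom(T_K, Z/2). *)
Lemma functional_mod2 {a n mu} : rep al a lam ->
  (forall m nu, Gamma al (tv m nu) -> (2 %| n * m + Lform mu nu)%Z) ->
  exists c : int, (2 %| n - c * a)%Z /\ exists nu, mu = c *: lam + 2 *: nu.
Proof.
move=> ral ev.
suff [c cP] : exists c : int, forall m nu,
    (2 %| (n * m + Lform mu nu) - c * (a * m + Lform lam nu))%Z.
  (* Evaluation at v gives the congruence for n; evaluation on Lambda' puts mu - c lambda in 2
     Lambda' by unimodularity. *)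
  exists c; split; first by have := cP 1 0; rewrite !Lform0r !addr0 !mulr1.
  have [|nu def_nu] := @Lform_dvd 2 (mu - c *: lam).
    by move=> y; have := cP 0 y; rewrite !LformE !mulr0 !add0r.
  by exists nu; rewrite -def_nu addrC subrK.
have [al0|] := pselect (forall m nu, Gamma al (tv m nu)).
  by exists 0 => m nu; rewrite mul0r subr0; apply: ev.
move=> /existsNP[m0 /existsNP[nu0 nG0]].
(* The constant c is the value at a fixed x0 with alpha(x0) odd; any x with alpha(x) odd differs
   from x0 by an element of Gamma_alpha. *)
exists (n * m0 + Lform mu nu0) => m nu.
have /odd_dvdz[z0 def0] : ~~ (2 %| a * m0 + Lform lam nu0)%Z.
  by apply/negP => /(Gamma_tv ral).
have [ev1|/odd_dvdz[z def_z]] := boolP (2 %| a * m + Lform lam nu)%Z.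
  by rewrite rpredB ?dvdz_mull // ev //; apply/(Gamma_tv ral).
have /ev : Gamma al (tv (m - m0) (nu - nu0)).
  apply/(Gamma_tv ral)/dvdzP; exists (z - z0); rewrite !LformE; lia.
rewrite !LformE => /dvdzP[q def_q]; apply/dvdzP.
exists (q - (n * m0 + Lform mu nu0) * z); rewrite def_z; lia.
Qed.

(** Let y = n v + mu. Its product with v, which is in Gamma, gives 4 | n; products with 2 Lambda'
    give mu in 4d Lambda'; the product with lambda, in Gamma as lambda^2 is even, puts y / 4 in
    Gamma. *)
Lemma disc_exponent_a0 : (0 < d)%N -> rep al 0 lam -> disc_exponent d al.
Proof.
move=> d_gt0 ral y; have [n [mu ->]] := tvP y => -[_ dv].
have Gl : Gamma al (tv 0 lam).
  by apply/(Gamma_tv ral)/dvdzP; exists (Lhalf lam); rewrite Lform_Lhalf; lia.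
have /dvdzP[n' def_n] : (4 %| n)%Z.
  have /dv : Gamma al (tv 1 0) by apply/(Gamma_tv ral); rewrite Lform0r.
  rewrite Tform_tv Lform0r => /dvdzP[q def_q]; apply/dvdzP; exists (- q).
  by apply: (@mulfI _ (2 * d%:Z)); lia.
have [nu def_mu] : exists nu, mu = (4 * d%:Z) *: nu.
  apply: Lform_dvd => nu; have := dv _ (Gamma_2 (tv 0 nu)).
  rewrite tvZ Tform_tv LformE => /dvdzP[q def_q]; apply/dvdzP; exists q; lia.
exists (tv n' (d%:Z *: nu)); last by rewrite tvZ def_n def_mu scalerA mulrC.
apply/(Gamma_tv ral); rewrite mul0r add0r LformE dvdz_mull //.
have := dv _ Gl; rewrite Tform_tv def_mu LformE (LformC nu) => /dvdzP[q def_q].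
by apply/dvdzP; exists q; apply: (@mulfI _ (4 * d%:Z)); lia.
Qed.

(** This vector is 8d p for p = - v / (4d) + lambda / 2, which represents the functional alpha / 2
    and so lies in Gamma^*. *)
Lemma dual_mul_a1 : rep al 1 lam -> dual_mul d al (8 * d%:Z) (tv (- 2) ((4 * d%:Z) *: lam)).
Proof.
move=> ral; split.
  apply/(Gamma_tv ral)/dvdzP; exists (2 * d%:Z * Lform lam lam - 1).
  rewrite LformE; ring.
move=> g; have [n [mu ->]] := tvP g => /(Gamma_tv ral)/dvdzP[q def_q].
rewrite Tform_tv LformE; apply/dvdzP; exists q.
have -> : Lform lam mu = q * 2 - n by lia.
ring.
Qed.

Lemma not_disc_exponent_a1 : rep al 1 lam -> ~ disc_exponent d al.
Proof.
move=> ral /(_ _ (dual_mul_a1 ral))[z _]; have [n [mu ->]] := tvP z.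
by rewrite tvZ => /tv_inj[]; lia.
Qed.

(** The vector y = lambda tests one direction. Conversely y = n v + c lambda + 2 nu, so y^2 is - 2d
    n^2 + c^2 lambda^2 modulo 4. *)
Lemma two_torsion_integral_a0 : ~~ odd d -> rep al 0 lam ->
  two_torsion_integral d al <-> (2 %| Lhalf lam)%Z.
Proof.
move=> evd ral; have [k def_d] : exists k : int, d%:Z = 2 * k by exists (d./2)%:Z; lia.
split=> [h|/dvdzP[q def_q] y].
  have /h : dual_mul d al 2 (tv 0 lam).
    split; first by apply/(Gamma_tv ral)/dvdzP; exists (Lhalf lam); rewrite Lform_Lhalf; lia.
    move=> g; have [n [mu ->]] := tvP g => /(Gamma_tv ral).
    by rewrite Tform_tv !mulr0 !mul0r.
  rewrite Tform_tv Lform_Lhalf => /dvdzP[q def_q]; apply/dvdzP; exists q; lia.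
have [n [mu ->]] := tvP y => -[_ dv].
have [|c [_ [nu ->]]] := @functional_mod2 0 0 mu ral.
  move=> m nu /dv; rewrite Tform_tv => /dvdzP[p def_p].
  by apply/dvdzP; exists (p + d%:Z * n * m); lia.
rewrite Tform_tv !LformE !(LformC nu) (Lform_Lhalf lam) def_q (Lform_Lhalf nu) def_d.
apply/dvdzP; exists (- k * n ^+ 2 + c ^+ 2 * q + c * Lform lam nu + 2 * Lhalf nu); ring.
Qed.

(** If lambda^2 / 2 is odd, - 2 v + 4d lambda attains the excluded value. If it is even, y = 2 n' v
    + 4 mu' has y^2 = - 8d n'^2 modulo 64, and d (1 - n'^2) is never 4 modulo 8. *)
Lemma eight_torsion_avoids_a1 : odd d -> rep al 1 lam ->
  eight_torsion_avoids d al <-> (2 %| Lhalf lam)%Z.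
Proof.
move=> oddd ral; have [k def_d] : exists k : int, d%:Z = 2 * k + 1 by exists (d./2)%:Z; lia.
split=> [h|/dvdzP[q def_q] y].
  apply/negPn/negP => /odd_dvdz[q def_q].
  have [Gy dv] := dual_mul_a1 ral.
  have /h/negP[] : dual_mul d al 8 (tv (- 2) ((4 * d%:Z) *: lam)).
    split=> // g /dv; apply: dvdz_trans; exact: dvdz_mulr.
  rewrite Tform_tv !LformE Lform_Lhalf def_q def_d; apply/dvdzP.
  exists ((2 * k + 1) ^+ 2 * q + 2 * k ^+ 2 + 2 * k - q + q); ring.
have [n [mu ->]] := tvP y => -[_ dv].
(* Since 2 x is in Gamma for every x in T_K, all products of y with T_K are divisible by 4. *)
have dv4 m nu : (4 %| - (2 * d%:Z) * n * m + Lform mu nu)%Z.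
  have := dv _ (Gamma_2 (tv m nu)); rewrite tvZ Tform_tv !LformE => /dvdzP[p def_p].
  apply/dvdzP; exists p; lia.
have [mu' def_mu] : exists mu', mu = 4 *: mu'.
  by apply: Lform_dvd => nu; have := dv4 0 nu; rewrite mulr0 add0r.
have [n' def_n] : exists n', n = 2 * n'.
  have := dv4 1 0; rewrite Lform0r => /dvdzP[p def_p].
  exists (- p - k * n); move: def_p; rewrite def_d; lia.
(* The product with y / 4 is integral on T_K and even on Gamma, so it is c alpha modulo 2; hence
   mu'^2 is divisible by 4. *)
have [|c [dvc [nu def_mu']]] := @functional_mod2 1 (- (d%:Z * n')) mu' ral.
  move=> m nu /dv; rewrite Tform_tv def_mu def_n LformE => /dvdzP[p def_p].
  apply/dvdzP; exists p; lia.
rewrite Tform_tv def_mu def_mu' !LformE !(LformC nu) (Lform_Lhalf lam) def_q (Lform_Lhalf nu).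
rewrite def_n; apply/negP => /dvdzP[p def_p].
have [r def_r] : exists r, d%:Z * (1 - n' ^+ 2) = 8 * r + 4.
  exists (p - (c ^+ 2 * q + c * Lform lam nu + 2 * Lhalf nu)); lia.
(* For n' even the left side of [def_r] is odd; for n' = 2 s + 1 it is - 4d s (s + 1), a multiple of
   8. *)
have [s [def_s|def_s]] : exists s, n' = 2 * s \/ n' = 2 * s + 1.
  have [/even_dvdz[s ->]|/odd_dvdz[s ->]] := boolP (2 %| n')%Z; exists s; by [left|right].
  move: def_r; rewrite def_s def_d.
  have -> : (2 * k + 1) * (1 - (2 * s) ^+ 2) = 2 * (k - 2 * (2 * k + 1) * s ^+ 2) + 1 by ring.
  lia.
have [t def_t] : exists t, s * (s + 1) = 2 * t.
  have [/even_dvdz[t ->]|/odd_dvdz[t ->]] := boolP (2 %| s)%Z.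
    by exists (t * (2 * t + 1)); ring.
  by exists ((2 * t + 1) * (t + 1)); ring.
move: def_r; rewrite def_s.
have -> : d%:Z * (1 - (2 * s + 1) ^+ 2) = - 4 * d%:Z * (s * (s + 1)) by ring.
rewrite def_t; lia.
Qed.

End Values.

(** * Discriminant groups *)

Lemma intZ_eq0 N (z : int) : (1 < N)%N -> (z%:~R == 0 :> 'Z_N) = (N %| z)%Z.
Proof.
have natZ n : (1 < N)%N -> (n%:R == 0 :> 'Z_N) = (N %| n)%N.
  by move=> N1; rewrite -val_eqE /= val_Zp_nat.
move=> N1; case: z => n; first by rewrite natZ.
by rewrite NegzE mulrNz oppr_eq0 natZ // dvdzE abszN.
Qed.

Lemma natrZ N (x : 'Z_N) : ((x : nat)%:Z)%:~R = x.
Proof. exact: natr_Zp. Qed.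

Notation intQ := (map_mx (fun z : int => z%:~R : rat)).

(** * Products of rational with integral vectors *)

Definition LformQ (p : 'cV[rat]_20) (mu : 'cV[int]_20) : rat :=
  (p^T *m intQ LamGram *m intQ mu) 0 0.

Definition TformQ (d : nat) (q : 'cV[rat]_21) (g : 'cV[int]_21) : rat :=
  (q^T *m intQ (TGram d) *m toQ g) 0 0.

Definition tvQ (x : rat) (p : 'cV[rat]_20) : 'cV[rat]_21 :=
  col_mx (x%:M : 'cV[rat]_1) p.

Lemma tvQP q : exists x p, q = tvQ x p.
Proof.
exists (usubmx (q : 'cV_(1 + 20)) 0 0), (dsubmx (q : 'cV_(1 + 20))).
by rewrite /tvQ -mx11_scalar vsubmxK.
Qed.

Lemma tvQ_inj x p y r : tvQ x p = tvQ y r -> x = y /\ p = r.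
Proof.
move=> /(@eq_col_mx _ 1 20 1) [] /matrixP/(_ 0 0) h ->.
by move: h; rewrite !mxE.
Qed.

Lemma toQ_tv n mu : toQ (tv n mu) = tvQ n%:~R (intQ mu).
Proof. by rewrite /toQ /tv (map_col_mx _ (m1:=1)) map_scalar_mx. Qed.

Lemma LformQDl p r mu : LformQ (p + r) mu = LformQ p mu + LformQ r mu.
Proof. by rewrite /LformQ linearD /= !mulmxDl mxE. Qed.

Lemma LformQZl c p mu : LformQ (c *: p) mu = c * LformQ p mu.
Proof. by rewrite /LformQ linearZ /= -!scalemxAl mxE. Qed.

Lemma LformQ_int nu mu : LformQ (intQ nu) mu = (Lform nu mu)%:~R.
Proof. by rewrite /LformQ map_trmx -!map_mxM mxE. Qed.

Lemma TformQ_tv d x p m mu :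
  TformQ d (tvQ x p) (tv m mu) = - (2 * d%:R) * x * m%:~R + LformQ p mu.
Proof.
rewrite /TformQ toQ_tv /tvQ /TGram (map_block_mx _ (m1:=1) (n1:=1)) !map_mx0.
rewrite (tr_col_mx (m1:=1)) (mul_row_block (n1:=1) (n2:=20) (p1:=1) (p2:=20)).
rewrite !mulmx0 addr0 add0r (mul_row_col (n1:=1)) mxE /LformQ; congr (_ + _).
rewrite tr_scalar_mx map_scalar_mx -!scalar_mxM mxE eqxx mulr1n /= rmorphN /= PoszM rmorphM /=.
ring.
Qed.

Lemma TformQD d q r g : TformQ d (q + r) g = TformQ d q g + TformQ d r g.
Proof. by rewrite /TformQ linearD /= !mulmxDl mxE. Qed.

Lemma LformQ_perfect p :
  (forall mu, LformQ p mu \is a Num.int) -> exists nu, p = intQ nu.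
Proof.
move=> int_p; pose r : 'rV[int]_20 := \row_j Num.floor ((p^T *m intQ LamGram) ord0 j).
have def_r : p^T *m intQ LamGram = intQ r.
  apply/rowP => j; rewrite [RHS]mxE [r _ _]mxE; apply/esym/eqP; rewrite -intrEfloor.
  have := int_p (delta_mx j ord0).
  by rewrite /LformQ map_delta_mx -colE mxE.
exists (r *m LamInv)^T; apply: trmx_inj; rewrite map_trmx trmxK map_mxM -def_r.
by rewrite -mulmxA -map_mxM LamGramK map_mx1 mulmx1.
Qed.

(** * Coordinates on the dual lattice *)

Section Discriminant.

Variables (d : nat) (al : Br2) (a : int) (lam : 'cV[int]_20).
Hypotheses (d_gt0 : (0 < d)%N) (ral : rep al a lam).

Let dQ : (d%:R : rat) != 0. Proof. by rewrite pnatr_eq0 -lt0n. Qed.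

(* The functional x |-> (c alpha + 2 (s n + nu.mu)) / 2 at x = n v + mu. *)
Definition dual_pt (c s : int) (nu : 'cV[int]_20) : 'cV[rat]_21 :=
  tvQ (- (c * a + 2 * s)%:~R / (4 * d%:R)) ((c%:~R / 2) *: intQ lam + intQ nu).

Lemma TformQ_dual_pt c s nu m mu : 2 * TformQ d (dual_pt c s nu) (tv m mu) =
  (c * (a * m + Lform lam mu) + 2 * (s * m + Lform nu mu))%:~R.
Proof.
rewrite TformQ_tv LformQDl LformQZl !LformQ_int !(intrD, intrM); field.
exact: dQ.
Qed.

(** As 2 x is in Gamma for every x in T_K, 2 q is an integral functional on T_K; being even on
    Gamma, it is c alpha modulo 2. *)
Lemma Gamma_dualP q : Gamma_dual d al q <-> exists c s nu, q = dual_pt c s nu.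
Proof.
split=> [dual_q|[c [s [nu ->]]] g]; last first.
  have [m [mu ->]] := tvP g => /(Gamma_tv ral)/dvdzP[t def_t].
  apply/intrP; exists (c * t + (s * m + Lform nu mu)).
  apply: (@mulfI _ 2) => //; rewrite [LHS]TformQ_dual_pt def_t.
  by rewrite !(intrD, intrM); ring.
have [x [p def_q]] := tvQP q.
have int2 g : 2 * TformQ d q g \is a Num.int.
  have := dual_q _ (Gamma_2 _ g); rewrite -/(TformQ d q _).
  have -> : TformQ d q (2 *: g) = 2 * TformQ d q g; last by [].
  by rewrite /TformQ /toQ map_mxZ -scalemxAr mxE.
have /intrP[n def_n] := int2 (tv 1 0).
have [|mu def_mu] := @LformQ_perfect (2 *: p).
  move=> mu; have := int2 (tv 0 mu).
  by rewrite def_q TformQ_tv LformQZl mulr0 add0r.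
have def_x : x = - n%:~R / (4 * d%:R).
  rewrite -def_n def_q TformQ_tv /LformQ map_mx0 mulmx0 mxE; field; exact: dQ.
have def_p : p = 2^-1 *: intQ mu by rewrite -def_mu scalerA mulVf ?scale1r.
have [|c [/dvdzP[s def_s] [nu def_nu]]] := @functional_mod2 al lam a n mu ral.
  move=> m nu /dual_q; rewrite -/(TformQ d q _) => /intrP[z def_z]; apply/dvdzP; exists z.
  apply: (@intr_inj rat); rewrite intrM -def_z def_q TformQ_tv def_x def_p LformQZl.
  rewrite LformQ_int intrD intrM; field; exact: dQ.
exists c, s, nu; rewrite def_q def_x def_p def_nu; congr tvQ.
  by congr (- _ %:~R / _); lia.
by apply/colP => i; rewrite !mxE !(intrD, intrM); field.
Qed.

(** Products of Gamma with Gamma^* are integers, so the floor is exact there and only serves to land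
    in [int]. *)
Definition pairing (g : 'cV[int]_21) (q : 'cV[rat]_21) : int := Num.floor (TformQ d q g).

Lemma pairing_dual_pt m mu t c s nu : a * m + Lform lam mu = 2 * t ->
  pairing (tv m mu) (dual_pt c s nu) = c * t + s * m + Lform nu mu.
Proof.
move=> def_t; rewrite /pairing.
have -> : TformQ d (dual_pt c s nu) (tv m mu) = (c * t + s * m + Lform nu mu)%:~R.
  apply: (@mulfI _ 2) => //; rewrite TformQ_dual_pt def_t !(intrD, intrM); ring.
exact: intrKfloor.
Qed.

Lemma pairingD g x y : Gamma al g -> Gamma_dual d al x -> Gamma_dual d al y ->
  pairing g (x + y) = pairing g x + pairing g y.
Proof.
move=> Gg dx dy; have [n Dn] := intrP (dx _ Gg); have [m Dm] := intrP (dy _ Gg).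
by rewrite /pairing TformQD /TformQ Dn Dm -intrD !intrKfloor.
Qed.

Lemma dual_pt_Gamma c s nu : (exists g, Gamma al g /\ dual_pt c s nu = toQ g) <->
  exists m mu, [/\ - (c * a + 2 * s) = 4 * d%:Z * m, c *: lam + 2 *: nu = 2 *: mu
    & (2 %| a * m + Lform lam mu)%Z].
Proof.
split=> [[g]|[m [mu [def_m def_mu ev]]]].
  have [m [mu ->]] := tvP g; rewrite toQ_tv => -[/(Gamma_tv ral) ev] /tvQ_inj[def_m def_mu].
  exists m, mu; split=> //.
    apply: (@intr_inj rat); rewrite !intrM -def_m mulrNz; field; exact: dQ.
  apply/colP => i; have /colP/(_ i) := def_mu; rewrite !mxE => def_i.
  by apply: (@intr_inj rat); rewrite !intrM -def_i !(intrD, intrM); field.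
exists (tv m mu); split; first exact/(Gamma_tv ral).
rewrite toQ_tv; congr tvQ.
  by rewrite -mulrNz def_m !intrM; field; exact: dQ.
apply/colP => i; have /colP/(_ i) := def_mu; rewrite !mxE => def_i.
have /(congr1 (fun z : int => z%:~R : rat)) := def_i; rewrite !(intrD, intrM) => def_iQ.
apply: (@mulfI _ 2) => //; by rewrite -def_iQ; field.
Qed.

End Discriminant.

(** Some mu0 has lambda.mu0 odd. Pairing with the elements v, 2 mu0 and lambda of Gamma, modulo 2d,
    2 and 2, sends [dual_pt] at c, s, nu to s, c and c lambda^2 / 2 + nu.lambda. *)
Lemma disc_iso_a0 d al lam : (0 < d)%N -> al != 0 -> rep al 0 lam ->
  disc_iso d al ('Z_(2 * d) * 'Z_2 * 'Z_2)%type.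
Proof.
move=> d_gt0 al0 ral.
have N1 : (1 < 2 * d)%N by lia.
have [mu0 [k def_k]] : exists mu0 k, Lform lam mu0 = 2 * k + 1.
  apply: contrapT => noz; case/eqP: al0; apply: alpha_ev_inj => x.
  have [n [mu ->]] := tvP x; rewrite [RHS]/alpha_ev mul0mx mxE.
  apply/eqP; rewrite ral intF2_eq0 mul0r add0r; apply: contrapT => /negP /odd_dvdz oddz.
  by apply: noz; exists mu.
pose phi q :=
  (pairing d (tv 1 0) q, pairing d (tv 0 (2 *: mu0)) q, pairing d (tv 0 lam) q).
have phi_pt c s nu : phi (dual_pt d 0 lam c s nu) =
    (s, c * (2 * k + 1) + 2 * Lform nu mu0, c * Lhalf lam + Lform nu lam).
  rewrite /phi; congr (_, _, _).
  - by rewrite (pairing_dual_pt d _ _ d_gt0 _ _ 0) !Lform0r //; ring.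
  - by rewrite (pairing_dual_pt d _ _ d_gt0 _ _ (2 * k + 1)) !LformE ?def_k; ring.
  - rewrite (pairing_dual_pt d _ _ d_gt0 _ _ (Lhalf lam)) ?Lform_Lhalf; ring.
exists (fun q => ((phi q).1.1%:~R, (phi q).1.2%:~R, (phi q).2%:~R)); split.
- have G1 : Gamma al (tv 1 0) by apply/(Gamma_tv ral); rewrite Lform0r.
  have G2 : Gamma al (tv 0 (2 *: mu0)).
    by apply/(Gamma_tv ral); rewrite mul0r add0r LformZr dvdz_mulr.
  have G3 : Gamma al (tv 0 lam).
    by apply/(Gamma_tv ral); rewrite mul0r add0r Lform_Lhalf dvdz_mulr.
  move=> x y dx dy; rewrite /phi /=.
  rewrite (pairingD d _ _ _ _ G1) // (pairingD d _ _ _ _ G2) //.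
  by rewrite (pairingD d _ _ _ _ G3) // !intrD.
(* Because lambda.mu0 is odd, a multiple of mu0 corrects the third component, and it changes the
   second by an even number only. *)
- move=> [[x y] z]; exists (dual_pt d 0 lam (y : nat)%:Z (x : nat)%:Z
    (((z : nat)%:Z - (y : nat)%:Z * Lhalf lam) *: mu0)).
  split; first by apply/(Gamma_dualP d _ _ _ d_gt0 ral); do 3!eexists.
  rewrite phi_pt /= natrZ !LformE (LformC mu0 lam) def_k.
  set y' := (y : nat)%:Z; set z' := (z : nat)%:Z.
  have modZ2 (u v : int) : (2 %| u - v)%Z -> u%:~R = v%:~R :> 'Z_2.
    by rewrite -(@intZ_eq0 2) // intrB subr_eq0 => /eqP.
  congr (_, _, _); rewrite -[RHS]natrZ; apply: modZ2; apply/dvdzP.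
    exists (y' * k + (z' - y' * Lhalf lam) * Lform mu0 mu0); rewrite /y'; ring.
  exists ((z' - y' * Lhalf lam) * k); rewrite /y' /z'; ring.
move=> x /(Gamma_dualP d _ _ _ d_gt0 ral)[c [s [nu ->]]].
rewrite (dual_pt_Gamma d _ _ _ d_gt0 ral) phi_pt /=; split.
  case=> /eqP; rewrite intZ_eq0 // => /dvdzP[s' def_s].
  move=> /eqP; rewrite intZ_eq0 // => /dvdzP[c' def_c].
  move=> /eqP; rewrite intZ_eq0 // => /dvdzP[w def_w].
  have [r def_r] : exists r, c = 2 * r by exists (c' - c * k - Lform nu mu0); lia.
  (* These are the coordinates of the point for s = 2d s' and c = 2 r; the third component is its
     product with lambda. *)
  exists (- s'), (r *: lam + nu); split.
  - by rewrite def_s PoszM; ring.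
  - by rewrite def_r; apply/colP => i; rewrite !mxE; ring.
  apply/dvdzP; exists w; rewrite !LformE Lform_Lhalf -def_w def_r (LformC nu); ring.
case=> m [mu [def_m def_mu /dvdzP[w def_w]]].
have E nu' : c * Lform lam nu' + 2 * Lform nu nu' = 2 * Lform mu nu'.
  by have := congr1 (fun x => Lform x nu') def_mu; rewrite !LformE.
congr (_, _, _); apply/eqP; rewrite intZ_eq0 //; apply/dvdzP.
- by exists (- m); rewrite PoszM; lia.
- by exists (Lform mu mu0); have := E mu0; rewrite def_k; lia.
by exists w; have := E lam; rewrite Lform_Lhalf (LformC mu); lia.
Qed.

(** The class of p, the vector representing alpha / 2, generates the group; the isomorphism is the
    product with 8d p modulo 8d. *)
Lemma disc_iso_a1 d al lam : (0 < d)%N -> rep al 1 lam -> disc_iso d al 'Z_(8 * d).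
Proof.
move=> d_gt0 ral; have N1 : (1 < 8 * d)%N by lia.
set g := tv (- 2) ((4 * d%:Z) *: lam).
have Gg : Gamma al g by have [] := dual_mul_a1 d _ _ ral.
have phi_pt c s nu : pairing d g (dual_pt d 1 lam c s nu) =
    c * (4 * d%:Z * Lhalf lam - 1) - 2 * s + 4 * d%:Z * Lform nu lam.
  rewrite (pairing_dual_pt d _ _ d_gt0 _ _ (4 * d%:Z * Lhalf lam - 1)).
    by rewrite !LformE; ring.
  by rewrite !LformE Lform_Lhalf; ring.
exists (fun q => (pairing d g q)%:~R); split.
- by move=> x y dx dy; rewrite (pairingD d _ _ _ _ Gg) // intrD.
(* With L = lambda^2 / 2, u^2 = 1 + 8d (2d L^2 - L), so u is its own inverse modulo 8d and the point
   j u p has image j. *)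
- move=> x; pose j := (x : nat)%:Z; pose u := 4 * d%:Z * Lhalf lam - 1.
  exists (dual_pt d 1 lam (j * u) 0 0).
  split; first by apply/(Gamma_dualP d _ _ _ d_gt0 ral); do 3!eexists.
  rewrite phi_pt Lform0l -[RHS]natrZ; apply/eqP; rewrite -subr_eq0 -intrB intZ_eq0 //.
  apply/dvdzP; exists (j * (2 * d%:Z * Lhalf lam ^+ 2 - Lhalf lam)).
  rewrite /u -/j PoszM; ring.
move=> x /(Gamma_dualP d _ _ _ d_gt0 ral)[c [s [nu ->]]].
rewrite (dual_pt_Gamma d _ _ _ d_gt0 ral) phi_pt; split.
  move=> /eqP; rewrite intZ_eq0 // => /dvdzP[w]; rewrite PoszM => def_w.
  pose L := c * Lhalf lam + Lform nu lam.
  (* Solving for c + 2 s shows that c is even and that the coordinates of the point are integral. *)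
  have def_c : c + 2 * s = 4 * d%:Z * (L - 2 * w) by rewrite /L; lia.
  pose r := 2 * d%:Z * (L - 2 * w) - s; have def_r : c = 2 * r by rewrite /r; lia.
  exists (2 * w - L), (r *: lam + nu); split.
  - by rewrite mulr1 def_c; ring.
  - by rewrite [in LHS]def_r; apply/colP => i; rewrite !mxE; ring.
  apply/dvdzP; exists w; rewrite !LformE Lform_Lhalf (LformC lam nu) /L; lia.
case=> m [mu [def_m def_mu /dvdzP[w def_w]]].
have E : c * (2 * Lhalf lam) + 2 * Lform nu lam = 2 * Lform lam mu.
  by have := congr1 (fun x => Lform x lam) def_mu; rewrite !LformE Lform_Lhalf (LformC mu).
apply/eqP; rewrite intZ_eq0 //; apply/dvdzP; exists w; rewrite PoszM.
rewrite mul1r in def_w.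
have -> : w * (8 * d%:Z) = 4 * d%:Z * (w * 2) by ring.
have LE : Lform lam mu = c * Lhalf lam + Lform nu lam by lia.
rewrite -def_w LE [RHS]mulrDr -def_m; ring.
Qed.

(** * Counting *)

Notation intF2 := (map_mx (fun z : int => z%:~R : 'F_2)).

(** * Gauss sums modulo 2 *)

Definition quad n (H : 'M['F_2]_n) (u : 'cV['F_2]_n) : 'F_2 := (u^T *m H *m u) 0 0.

Definition sgF2 (x : 'F_2) : int := if x == 0 then 1 else -1.

Lemma sgF2D x y : sgF2 (x + y) = sgF2 x * sgF2 y.
Proof. by case: x y => [[|[|//]] ?] [[|[|//]] ?]. Qed.

Definition gauss n (H : 'M['F_2]_n) : int := \sum_u sgF2 (quad n H u).

Lemma gauss_block n m (A : 'M_n) (B : 'M_m) :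
  gauss (n + m) (block_mx A 0 0 B) = gauss n A * gauss m B.
Proof.
rewrite /gauss big_distrlr pair_big /=.
rewrite (reindex (fun p : 'cV['F_2]_n * 'cV['F_2]_m => col_mx p.1 p.2)) /=; last first.
  exists (fun u => (usubmx u, dsubmx u)) => [[u v] _|u _] /=.
    by rewrite col_mxKu col_mxKd.
  exact: vsubmxK.
apply: eq_bigr => -[u v] _ /=; rewrite -sgF2D /quad tr_col_mx mul_row_block.
by rewrite !mulmx0 addr0 add0r mul_row_col mxE.
Qed.

(** Sums over F_2^n by recursion on Boolean lists, a form that [vm_compute] can evaluate. *)
Fixpoint sum_bits (n : nat) (f : seq bool -> int) : int :=
  if n is n'.+1 then
    sum_bits n' (fun l => f (false :: l)) + sum_bits n' (fun l => f (true :: l))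
  else f [::].

Definition bits_col n (l : seq bool) : 'cV['F_2]_n := \col_i (nth false l i)%:R.

Lemma sum_bitsP n (F : 'cV['F_2]_n -> int) :
  \sum_u F u = sum_bits n (fun l => F (bits_col n l)).
Proof.
elim: n F => [|n IHn] F /=.
  rewrite (big_pred1 (bits_col 0 [::])) // => u.
  by apply/esym/eqP/colP => -[].
rewrite (reindex (fun p : 'F_2 * 'cV['F_2]_n => col_mx (p.1%:M : 'cV_1) p.2)) /=; last first.
  exists (fun u : 'cV_(1 + n) => (u 0 0, dsubmx u)) => [[x v] _|u _] /=.
    congr (_, _); last exact: (col_mxKd (m1 := 1)).
    transitivity ((x%:M : 'cV_1) 0 0); last by rewrite mxE eqxx.
    rewrite -[RHS](col_mxEu (m1 := 1) _ v); congr fun_of_matrix; exact: val_inj.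
  rewrite -[RHS]vsubmxK; congr col_mx; rewrite [RHS]mx11_scalar mxE.
  by congr (u _ _)%:M; apply: val_inj.
rewrite -(pair_bigA _ (fun x v => F (col_mx (x%:M : 'cV_1) v))) /=.
rewrite (big_ord_recl 1) big_ord_recl big_ord0 addr0 !IHn.
have col_cons (b : bool) (x : 'F_2) l : x = b%:R ->
    col_mx (x%:M : 'cV_1) (bits_col n l) = bits_col n.+1 (b :: l).
  move=> ->; apply/colP => i; rewrite [RHS]mxE -[i](@splitK 1 n).
  case: (split i) => j /=; first by rewrite (col_mxEu (m1 := 1)) mxE !ord1.
  by rewrite (col_mxEd (m1 := 1)) mxE.
congr (_ + _); congr sum_bits; apply: funext => l; congr F; apply: col_cons.
  exact: val_inj.
exact: val_inj.
Qed.

(** The value u^T H u in Booleans: products are conjunctions and sums are exclusive or. *)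
Definition quad_bits (h : nat -> nat -> bool) (n : nat) (l : seq bool) : bool :=
  foldr (fun j b => foldr (fun i c => nth false l i && h i j && nth false l j (+) c)
                          false (iota 0 n) (+) b) false (iota 0 n).

Lemma natrF2_addb b c : ((b (+) c)%:R : 'F_2) = b%:R + c%:R.
Proof. by case: b c => [] []; apply: val_inj. Qed.

Lemma sum_natrF2 n (f : nat -> bool) :
  \sum_(i < n) (f i)%:R = (foldr (fun i b => f i (+) b) false (iota 0 n))%:R :> 'F_2.
Proof.
rewrite -(big_mkord xpredT (fun i => (f i)%:R)) /index_iota subn0.
elim: (iota 0 n) => [|i s IHs]; first by rewrite big_nil.
by rewrite big_cons IHs /= natrF2_addb.
Qed.

Lemma gauss_bits n (h : nat -> nat -> bool) (H : 'M['F_2]_n) :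
  (forall i j : 'I_n, H i j = (h i j)%:R) ->
  gauss n H = sum_bits n (fun l => if quad_bits h n l then -1 else 1).
Proof.
move=> defH; rewrite /gauss sum_bitsP; congr sum_bits; apply: funext => l.
have -> : quad n H (bits_col n l) = (quad_bits h n l)%:R; last first.
  by rewrite /sgF2; case: quad_bits.
rewrite /quad /quad_bits mxE -sum_natrF2; apply: eq_bigr => j _.
rewrite mxE mulr_suml.
rewrite -(sum_natrF2 n (fun i => nth false l i && h i j && nth false l j)).
apply: eq_bigr => i _; rewrite !mxE defH.
by rewrite -!natrM !mulnb.
Qed.

Lemma gauss_U : gauss 2 (intF2 Uhalf) = 2.
Proof.
rewrite (gauss_bits 2 (fun i j => (i < j)%N)); first by vm_compute.
by move=> i j; rewrite !mxE; case: (i < j)%N.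
Qed.

Definition E8bit (i j : nat) : bool :=
  (i == j) || (i < j)%N && (((i + 1 == j) && (j <= 6)) || ((i == 4) && (j == 7)))%N.

Lemma gauss_E8 : gauss 8 (intF2 E8half) = 16.
Proof.
rewrite (gauss_bits 8 E8bit); first by vm_compute.
move=> i j; rewrite !mxE.
case: i j => [[|[|[|[|[|[|[|[|//]]]]]]]] ?] [[|[|[|[|[|[|[|[|//]]]]]]]] ?];
by apply: val_inj.
Qed.

Lemma gauss_Lam : gauss 20 (intF2 LamHalf) = 1024.
Proof.
rewrite /LamHalf (map_block_mx _ (m1:=4) (n1:=4) (m2:=16) (n2:=16)).
rewrite (map_block_mx _ (m1:=2) (n1:=2)) (map_block_mx _ (m1:=8) (n1:=8)) !map_mx0.
by rewrite (gauss_block 4 16) (gauss_block 2 2) (gauss_block 8 8) gauss_U gauss_E8.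
Qed.

(** * Cardinalities *)

Notation qLam := (quad 20 (intF2 LamHalf)).

Lemma card_cV20 : #|{: 'cV['F_2]_20}| = (2 ^ 20)%N.
Proof. by rewrite card_mx card_Fp // muln1. Qed.

(** The two counts have sum 2^20, and their difference is the Gauss sum 2^10. *)
Lemma card_quad :
  #|[set u | qLam u == 0]| = (2 ^ 9 * (2 ^ 10 + 1))%N /\
  #|[set u | qLam u != 0]| = (2 ^ 9 * (2 ^ 10 - 1))%N.
Proof.
set N0 := #|_|; set N1 := #|_|.
have sumN : (N0 + N1 = 2 ^ 20)%N.
  rewrite -card_cV20 -(cardC [set u | qLam u == 0]); congr (_ + _)%N.
  by apply: eq_card => u; rewrite !inE.
have diffN : N0%:Z - N1%:Z = 1024.
  rewrite -gauss_Lam /gauss (bigID (fun u => qLam u == 0)) /=.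
  rewrite (eq_bigr (fun=> 1)) => [|u /eqP ->]; last by rewrite /sgF2 eqxx.
  rewrite [X in _ = _ + X](eq_bigr (fun=> -1)) => [|u /negbTE]; last by rewrite /sgF2 => ->.
  rewrite !sumr_const mulNrn !natz /N0 /N1; congr (_%:Z - _%:Z);
  by apply: eq_card => u; rewrite !inE.
by split; lia.
Qed.

(** Coordinates a and lambda modulo 2 on Br(K)_2; unimodularity makes this a bijection, so counting
    takes place in Lambda'/2. *)
Definition Br2_of (c : 'F_2) (u : 'cV['F_2]_20) : Br2 :=
  row_mx (c%:M : 'rV_1) (u^T *m intF2 LamGram).

Definition liftF2 (u : 'cV['F_2]_20) : 'cV[int]_20 := \col_i (u i 0 : nat)%:Z.

Lemma liftF2K u : intF2 (liftF2 u) = u.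
Proof. by apply/colP => i; rewrite !mxE natrF2. Qed.

Lemma rep_Br2_of c u : rep (Br2_of c u) (c : nat)%:Z (liftF2 u).
Proof.
move=> n mu; rewrite alpha_ev_tv intrD intrM natrF2; congr (_ * _ + _).
  transitivity ((c%:M : 'rV['F_2]_1) 0 0); last by rewrite mxE eqxx.
  rewrite -(row_mxEl (n1 := 1) _ (u^T *m intF2 LamGram)).
  by rewrite /a_of; congr fun_of_matrix; apply: val_inj.
rewrite row_mxKr -[in LHS](liftF2K u).
by rewrite map_trmx -!map_mxM mxE.
Qed.

Lemma a_of_Br2_of c u : a_of (Br2_of c u) = c.
Proof. by rewrite (rep_a (rep_Br2_of c u)) natrF2. Qed.

Lemma Br2_of_inj c : injective (Br2_of c).
Proof.
move=> u v /(@eq_row_mx _ 1 1 20) [_ eq_uv].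
have := congr1 (fun r => r *m intF2 LamInv) eq_uv.
by rewrite -!mulmxA -map_mxM LamGramK map_mx1 !mulmx1 => /trmx_inj.
Qed.

Lemma Br2_ofP al : exists u, al = Br2_of (a_of al) u.
Proof.
exists (rsubmx (al : 'rV_(1 + 20)) *m intF2 LamInv)^T.
rewrite /Br2_of trmxK -mulmxA -map_mxM LamInvK map_mx1 mulmx1.
suff -> : (a_of al)%:M = lsubmx (al : 'rV_(1 + 20)) by rewrite hsubmxK.
by rewrite [RHS]mx11_scalar mxE /a_of; congr (al _ _)%:M; apply: val_inj.
Qed.

Lemma Lhalf_liftF2 u : (2 %| Lhalf (liftF2 u))%Z = (qLam u == 0).
Proof.
rewrite -intF2_eq0 -[in RHS](liftF2K u); congr (_ == _).
by rewrite /quad map_trmx -!map_mxM mxE.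
Qed.

Lemma lam_sq0P {al a lam} : rep al a lam -> lam_sq al 0 <-> (2 %| Lhalf lam)%Z.
Proof. by move=> /(lam_sqP 0); rewrite mulr0 subr0. Qed.

Lemma lam_sq2P {al a lam} : rep al a lam -> lam_sq al 2 <-> ~~ (2 %| Lhalf lam)%Z.
Proof.
move=> /(lam_sqP 1); rewrite mulr1 => ->.
split=> [/dvdzP[q Hq]|/odd_dvdz[k ->]]; last by rewrite addrK dvdz_mulr.
by apply/negP => /dvdzP[r Hr]; lia.
Qed.

Lemma lam_sq_dichotomy al :
  (lam_sq al 0 \/ lam_sq al 2) /\ ~ (lam_sq al 0 /\ lam_sq al 2).
Proof.
have [lam ral] := rep_ex al; rewrite (lam_sq0P ral) (lam_sq2P ral).
by case: (2 %| _)%Z; split=> //; [left|case|right|case].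
Qed.

Lemma lam_sq_Br2_of c u :
  `[< lam_sq (Br2_of c u) 0 >] = (qLam u == 0) /\
  `[< lam_sq (Br2_of c u) 2 >] = (qLam u != 0).
Proof.
rewrite -Lhalf_liftF2; split; apply/asboolP/idP.
- by move/(lam_sq0P (rep_Br2_of c u)).
- by move/(lam_sq0P (rep_Br2_of c u)).
- by move/(lam_sq2P (rep_Br2_of c u)).
- by move/(lam_sq2P (rep_Br2_of c u)).
Qed.

Lemma card_Br2_of c (P : pred Br2) :
  #|[set al : Br2 | (a_of al == c) && P al]| = #|[set u | P (Br2_of c u)]|.
Proof.
rewrite -(card_imset _ (Br2_of_inj c)); apply: eq_card => al; rewrite inE.
apply/andP/imsetP => [[/eqP ac Pal]|[u]]; last first.
  by rewrite inE => Pu ->; rewrite a_of_Br2_of eqxx.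
have [u def_al] := Br2_ofP al; rewrite ac in def_al.
by exists u; rewrite // inE -def_al.
Qed.

Lemma Br2_of0 : Br2_of 0 0 = 0.
Proof.
rewrite /Br2_of trmx0 mul0mx raddf0. by rewrite row_mx0.
Qed.

Lemma card_Br2_of_nz (P : pred Br2) :
  #|[set al : Br2 | [&& al != 0, a_of al == 0 & P al]]| =
  #|[set u | P (Br2_of 0 u)] :\ 0|.
Proof.
have -> : [set al : Br2 | [&& al != 0, a_of al == 0 & P al]] =
    [set al | (a_of al == 0) && ((al != 0) && P al)].
  by apply/setP => al; rewrite !inE andbCA.
rewrite card_Br2_of; apply: eq_card => u; rewrite !inE; congr (~~ _ && _).
by rewrite -[X in _ == X]Br2_of0 (inj_eq (Br2_of_inj 0)).
Qed.

Lemma quad0 n (H : 'M_n) : quad n H 0 = 0.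
Proof. by rewrite /quad mulmx0 mxE. Qed.

Lemma card_a1 : #|[set al : Br2 | a_of al == 1]| = (2 ^ 20)%N.
Proof.
rewrite -card_cV20 -cardsT -[RHS](card_Br2_of 1 xpredT).
by apply: eq_card => al; rewrite !inE andbT.
Qed.

Lemma card_a1_sq0 : #|[set al : Br2 | (a_of al == 1) && `[< lam_sq al 0 >]]|
  = (2 ^ 9 * (2 ^ 10 + 1))%N.
Proof.
rewrite card_Br2_of -(proj1 card_quad); apply: eq_card => u.
by rewrite !inE (proj1 (lam_sq_Br2_of _ _)).
Qed.

Lemma card_a1_sq2 : #|[set al : Br2 | (a_of al == 1) && `[< lam_sq al 2 >]]|
  = (2 ^ 9 * (2 ^ 10 - 1))%N.
Proof.
rewrite card_Br2_of -(proj2 card_quad); apply: eq_card => u.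
by rewrite !inE (proj2 (lam_sq_Br2_of _ _)).
Qed.

Lemma card_a0 : #|[set al : Br2 | (al != 0) && (a_of al == 0)]| = (2 ^ 20 - 1)%N.
Proof.
rewrite -card_cV20 -cardsT (cardsD1 0 [set: _]) inE addKn.
rewrite -[RHS](card_Br2_of_nz xpredT).
by apply: eq_card => al; rewrite !inE andbT.
Qed.

(** The excluded class alpha = 0 has lambda = 0, so the 1 is subtracted from this count and not from
    the other. *)
Lemma card_a0_sq0 : #|[set al : Br2 | [&& al != 0, a_of al == 0 & `[< lam_sq al 0 >]]]|
  = (2 ^ 9 * (2 ^ 10 + 1) - 1)%N.
Proof.
rewrite card_Br2_of_nz -(proj1 card_quad) (cardsD1 0 [set u | qLam u == 0]).
rewrite inE quad0 eqxx addKn; apply: eq_card => u.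
by rewrite !inE (proj1 (lam_sq_Br2_of _ _)).
Qed.

Lemma card_a0_sq2 : #|[set al : Br2 | [&& al != 0, a_of al == 0 & `[< lam_sq al 2 >]]]|
  = (2 ^ 9 * (2 ^ 10 - 1))%N.
Proof.
rewrite card_Br2_of_nz -(proj2 card_quad) (cardsD1 0 [set u | qLam u != 0]).
rewrite inE quad0 eqxx add0n; apply: eq_card => u.
by rewrite !inE (proj2 (lam_sq_Br2_of _ _)).
Qed.

(** * Isometry classes *)

Lemma isometric_disc_exponent d al be :
  isometric d al be -> disc_exponent d al <-> disc_exponent d be.
Proof. by case=> f [fG fD fT f_inj f_surj]; apply: disc_exponent_isom f_surj. Qed.

Lemma isometric_two_torsion d al be :
  isometric d al be -> two_torsion_integral d al <-> two_torsion_integral d be.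
Proof. by case=> f [fG fD fT f_inj f_surj]; apply: two_torsion_integral_isom f_surj. Qed.

Lemma isometric_eight_torsion d al be :
  isometric d al be -> eight_torsion_avoids d al <-> eight_torsion_avoids d be.
Proof. by case=> f [fG fD fT f_inj f_surj]; apply: eight_torsion_avoids_isom f_surj. Qed.

Lemma F2_cases (x : 'F_2) : x = 0 \/ x = 1.
Proof. by case: x => [[|[|//]] ?]; [left|right]; apply: val_inj. Qed.

Lemma rep_a0 {al} : a_of al = 0 -> exists lam, rep al 0 lam.
Proof. by move=> a0; have := rep_ex al; rewrite a0. Qed.

Lemma rep_a1 {al} : a_of al = 1 -> exists lam, rep al 1 lam.
Proof. by move=> a1; have := rep_ex al; rewrite a1. Qed.

Lemma a1_neq0 {al} : a_of al = 1 -> al != 0.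
Proof. by apply: contra_eqN => /eqP ->; rewrite /a_of mxE. Qed.

Lemma isometric_parity {d a al be lam mu} : ~~ (2 %| a - d%:Z)%Z ->
  al != 0 -> be != 0 -> rep al a lam -> rep be a mu -> isometric d al be.
Proof.
move=> odd_ad al0 be0 ral rbe; apply: gequiv_isometric.
have [ga [de [p [q [_ _ _ _ albe]]]]] := gequiv_classify d _ _ _ _ _ al0 be0 ral rbe.
by apply: albe; left.
Qed.

(** Here [I] is any isometry invariant that detects the parity of lambda^2 / 2. Evaluated on the
    canonical forms, it shows that p - q is even. *)
Lemma isometric_iff_lam_sq d a (I : Br2 -> Prop) :
  (forall x y, isometric d x y -> I x <-> I y) ->
  (forall x lam, rep x a lam -> I x <-> (2 %| Lhalf lam)%Z) ->
  forall al be lam mu, al != 0 -> be != 0 -> rep al a lam -> rep be a mu ->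
    isometric d al be <-> (lam_sq al 0 <-> lam_sq be 0).
Proof.
move=> I_isom I_sq al be lam mu al0 be0 ral rbe.
rewrite (lam_sq0P ral) (lam_sq0P rbe) -(I_sq _ _ ral) -(I_sq _ _ rbe).
split=> [|eqI]; first exact: I_isom.
have [ga [de [p [q [alga bede rga rde albe]]]]] :=
  gequiv_classify d _ _ _ _ _ al0 be0 ral rbe.
apply/gequiv_isometric/albe; right.
move: eqI; rewrite (I_isom _ _ (gequiv_isometric _ _ _ alga)).
rewrite (I_isom _ _ (gequiv_isometric _ _ _ bede)) (I_sq _ _ rga) (I_sq _ _ rde).
rewrite !Lhalf_canonical => eqpq.
have [evp|odd_p] := boolP (2 %| p)%Z; first by rewrite rpredB //; apply/eqpq.
have /odd_dvdz[t ->] : ~~ (2 %| q)%Z by apply: contra odd_p => /eqpq.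
by have [s ->] := odd_dvdz _ odd_p; apply/dvdzP; exists (s - t); ring.
Qed.

Lemma isometric_a0_odd d al be : odd d -> al != 0 -> a_of al = 0 -> be != 0 ->
  a_of be = 0 -> isometric d al be.
Proof.
move=> oddd al0 /rep_a0[lam ral] be0 /rep_a0[mu rbe].
by apply: (isometric_parity _ al0 be0 ral rbe); apply/negP => /dvdzP[k def_k]; lia.
Qed.

Lemma isometric_a0_even d al be : ~~ odd d -> al != 0 -> a_of al = 0 -> be != 0 ->
  a_of be = 0 -> isometric d al be <-> (lam_sq al 0 <-> lam_sq be 0).
Proof.
move=> evd al0 /rep_a0[lam ral] be0 /rep_a0[mu rbe].
apply: (isometric_iff_lam_sq _ _ _ (isometric_two_torsion d) _ _ _ _ _ al0 be0 ral rbe).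
by move=> x nu; apply: two_torsion_integral_a0.
Qed.

Lemma isometric_a1_even d al be : ~~ odd d -> a_of al = 1 -> a_of be = 1 ->
  isometric d al be.
Proof.
move=> evd a1 b1; have [lam ral] := rep_a1 a1; have [mu rbe] := rep_a1 b1.
apply: (isometric_parity _ (a1_neq0 a1) (a1_neq0 b1) ral rbe).
by apply/negP => /dvdzP[k def_k]; lia.
Qed.

Lemma isometric_a1_odd d al be : odd d -> a_of al = 1 -> a_of be = 1 ->
  isometric d al be <-> (lam_sq al 0 <-> lam_sq be 0).
Proof.
move=> oddd a1 b1; have [lam ral] := rep_a1 a1; have [mu rbe] := rep_a1 b1.
apply: (isometric_iff_lam_sq _ _ _ (isometric_eight_torsion d) _ _ _ _ _
          (a1_neq0 a1) (a1_neq0 b1) ral rbe).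
by move=> x nu; apply: eight_torsion_avoids_a1.
Qed.

Lemma not_isometric_a d al be : (0 < d)%N -> a_of al != a_of be -> ~ isometric d al be.
Proof.
move=> d_gt0 neq_a /isometric_disc_exponent.
have [al0|al1] := F2_cases (a_of al); have [be0|be1] := F2_cases (a_of be).
- by rewrite al0 be0 eqxx in neq_a.
- have [lam ral] := rep_a0 al0; have [mu rbe] := rep_a1 be1.
  by move=> [/(_ (disc_exponent_a0 _ _ _ d_gt0 ral)) /(not_disc_exponent_a1 _ _ _ rbe)].
- have [lam ral] := rep_a1 al1; have [mu rbe] := rep_a0 be0.
  by move=> [_ /(_ (disc_exponent_a0 _ _ _ d_gt0 rbe)) /(not_disc_exponent_a1 _ _ _ ral)].
- by rewrite al1 be1 eqxx in neq_a.
Qed.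

Lemma canonical_ex (a q : int) : exists al, [/\ al != 0, a_of al = a%:~R
  & lam_sq al 0 <-> (2 %| q)%Z].
Proof.
have [al ral] := rep_mk a (f1 + q *: e1); exists al.
rewrite (canonical_neq0 _ _ _ ral) (rep_a ral); split=> //.
by rewrite (lam_sq0P ral) Lhalf_canonical.
Qed.

Lemma three_classes d : (0 < d)%N -> exists al1 al2 al3 : Br2,
  [/\ al1 != 0, al2 != 0, al3 != 0,
      [/\ ~ isometric d al1 al2, ~ isometric d al1 al3 & ~ isometric d al2 al3]
    & forall al : Br2, al != 0 ->
        [\/ isometric d al al1, isometric d al al2 | isometric d al al3]].
Proof.
move=> d_gt0.
have [al1 [nz1 a1 sq1]] := canonical_ex 0 0.
have [al2 [nz2 a2 sq2]] := canonical_ex 0 1.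
have [al3 [nz3 a3 sq3]] := canonical_ex 1 0.
have [al4 [nz4 a4 sq4]] := canonical_ex 1 1.
(* The value of a with a + d even is the one that splits into two classes: a = 1 for d odd, a = 0
   for d even. *)
have [oddd|evd] := boolP (odd d); [exists al1, al3, al4|exists al1, al2, al3]; split=> //.
- split; try by apply: not_isometric_a => //; rewrite ?a1 ?a3 ?a4.
  by move=> /(isometric_a1_odd _ _ _ oddd a3 a4); rewrite sq3 sq4 => -[/(_ isT)].
- move=> al nz; have [a0|a1'] := F2_cases (a_of al).
    by apply: Or31; apply: isometric_a0_odd.
  have [sq|nsq] := pselect (lam_sq al 0).
    by apply: Or32; apply/isometric_a1_odd; rewrite // sq3.
  by apply: Or33; apply/isometric_a1_odd; rewrite // sq4.
- split; try by apply: not_isometric_a => //; rewrite ?a1 ?a2 ?a3.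
  by move=> /(isometric_a0_even _ _ _ evd nz1 a1 nz2 a2); rewrite sq1 sq2 => -[/(_ isT)].
- move=> al nz; have [a0|a1'] := F2_cases (a_of al).
    have [sq|nsq] := pselect (lam_sq al 0).
      by apply: Or31; apply/isometric_a0_even; rewrite // sq1.
    by apply: Or32; apply/isometric_a0_even; rewrite // sq2.
  by apply: Or33; apply: isometric_a1_even.
Qed.

Theorem theorem2p3 (d : nat) (hd : (0 < d)%N) :
  (* the nonzero alpha fall into exactly three isometry classes of Gamma_alpha *)
  (exists al1 al2 al3 : Br2,
     [/\ al1 != 0, al2 != 0, al3 != 0,
         [/\ ~ isometric d al1 al2, ~ isometric d al1 al3 & ~ isometric d al2 al3]
       & forall al : Br2, al != 0 ->
           [\/ isometric d al al1, isometric d al al2 | isometric d al al3]]) /\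
  (* (1) a_alpha = 0 *)
  ((forall al : Br2, al != 0 -> a_of al = 0 ->
      disc_iso d al ('Z_(2 * d) * 'Z_2 * 'Z_2)%type) /\
   #|[set al : Br2 | (al != 0) && (a_of al == 0)]| = (2 ^ 20 - 1)%N /\
   (~~ odd d ->
      [/\ #|[set al : Br2 | [&& al != 0, a_of al == 0 & `[< lam_sq al 0 >]]]|
            = (2 ^ 9 * (2 ^ 10 + 1) - 1)%N,
          #|[set al : Br2 | [&& al != 0, a_of al == 0 & `[< lam_sq al 2 >]]]|
            = (2 ^ 9 * (2 ^ 10 - 1))%N,
          (forall al : Br2, al != 0 -> a_of al = 0 ->
             (lam_sq al 0 \/ lam_sq al 2) /\ ~ (lam_sq al 0 /\ lam_sq al 2))
        & (forall al be : Br2, al != 0 -> a_of al = 0 -> be != 0 -> a_of be = 0 ->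
             (isometric d al be <-> (lam_sq al 0 <-> lam_sq be 0)))]) /\
   (odd d ->
      forall al be : Br2, al != 0 -> a_of al = 0 -> be != 0 -> a_of be = 0 ->
        isometric d al be)) /\
  (* (2) a_alpha = 1 *)
  ((forall al : Br2, a_of al = 1 -> disc_iso d al 'Z_(8 * d)) /\
   #|[set al : Br2 | a_of al == 1]| = (2 ^ 20)%N /\
   (~~ odd d ->
      forall al be : Br2, a_of al = 1 -> a_of be = 1 -> isometric d al be) /\
   (odd d ->
      [/\ #|[set al : Br2 | (a_of al == 1) && `[< lam_sq al 0 >]]|
            = (2 ^ 9 * (2 ^ 10 + 1))%N,
          #|[set al : Br2 | (a_of al == 1) && `[< lam_sq al 2 >]]|
            = (2 ^ 9 * (2 ^ 10 - 1))%N,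
          (forall al : Br2, a_of al = 1 ->
             (lam_sq al 0 \/ lam_sq al 2) /\ ~ (lam_sq al 0 /\ lam_sq al 2))
        & (forall al be : Br2, a_of al = 1 -> a_of be = 1 ->
             (isometric d al be <-> (lam_sq al 0 <-> lam_sq be 0)))])) /\
  (* lattices with different a_alpha are never isometric *)
  (forall al be : Br2, al != 0 -> be != 0 -> a_of al != a_of be -> ~ isometric d al be).
Proof.
split; first exact: three_classes.
split.
  split.
    by move=> al nz /rep_a0[lam ral]; apply: disc_iso_a0 ral.
  split; first exact: card_a0.
  split=> [evd|oddd]; last by move=> al be; apply: isometric_a0_odd.
  split; [exact: card_a0_sq0|exact: card_a0_sq2| |].
    by move=> al _ _; apply: lam_sq_dichotomy.
  by move=> al be; apply: isometric_a0_even.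
split; last by move=> al be _ _; apply: not_isometric_a.
split; first by move=> al /rep_a1[lam ral]; apply: disc_iso_a1 ral.
split; first exact: card_a1.
split=> [evd|oddd]; first by move=> al be; apply: isometric_a1_even.
split; [exact: card_a1_sq0|exact: card_a1_sq2| |].
  by move=> al _; apply: lam_sq_dichotomy.
by move=> al be; apply: isometric_a1_odd.
Qed.
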